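(* Let $n\ge 1$ be an integer, let $\underline{\omega} = (\omega_1, \dots, \omega_n) \in \mathbb{D}^n$ and let $f:\mathbb{D}^n\to\mathbb{D}$ be holomorphic. Then $$|D_2f(\underline{\omega})| \leq 2 \left(1 - |D_1f(\underline{\omega})|^2\right).$$
   Context: $\mathbb{D}$ is the open unit disk in $\mathbb{C}$. Given $f:\mathbb{D}^n\to\mathbb{D}$ holomorphic and $\underline{\omega}=(\omega_1,\dots,\omega_n)\in\mathbb{D}^n$, define the holomorphic function $g$ on $\mathbb{D}^n$ by $$g(z_1,\dots,z_n)= \frac{f\left(\frac{z_1+\omega_1}{1+\overline{\omega_1}z_1}, \dots , \frac{z_n+\omega_n}{1+\overline{\omega_n}z_n }\right)-f(\underline{\omega})}{1-\overline{f(\underline{\omega})}f\left(\frac{z_1+\omega_1}{1+\overline{\omega_1}z_1}, \dots , \frac{z_n+\omega_n}{1+\overline{\omega_n}z_n }\right)} .$$ The first two (Peschl-type) invariant derivatives of $f$ at $\underline{\omega}$ are $$D_1f(\underline{\omega})=\sum_{j=1}^n \frac{\partial g}{\partial z_j}(0)=\sum_{j=1}^{n} \frac{1-|\omega_j|^2}{1-|f(\underline{\omega})|^2}\, \frac{\partial f}{\partial z_j}(\underline{\omega}),$$ $$D_2f(\underline{\omega})=\sum_{j=1}^n\frac{\partial^2 g}{\partial z_j^2}(0)+2\sum_{1\le j<k\le n}\frac{\partial^2 g}{\partial z_j\partial z_k}(0).$$ *)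

(* Defs.v *)
From HB Require Import structures.
From mathcomp Require Import all_boot all_order all_algebra.
From mathcomp Require Import complex.
From mathcomp Require Import boolp classical_sets reals topology normedtype.
From mathcomp Require Import derive.

Set Implicit Arguments.
Unset Strict Implicit.
Unset Printing Implicit Defensive.

Import Order.TTheory GRing.Theory Num.Theory.
Import numFieldNormedType.Exports.

Local Open Scope ring_scope.

(* The library puts the norm topology on abstract numeric fields, but not on
   R[i]; here R[i] is a normed space over itself, so differentiable and 'D_v
   at functions 'rV[R[i]]_n -> R[i] are the complex notions. *)
HB.instance Definition _ (R : rcfType) := PseudoPointedMetric.copy R[i] R[i]^o.
HB.instance Definition _ (R : rcfType) := NormedModule.copy R[i] R[i]^o.

Section Defs.
Context {R : realType} {n : nat}.
Local Notation C := R[i].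
Implicit Types (f : 'rV[C]_n -> C) (w z : 'rV[C]_n).

Definition polydisc : set 'rV[C]_n :=
  [set z | forall j, `|z ord0 j| < 1]%classic.

(* f is only meaningful on polydisc, which is open, so its values elsewhere
   have no effect on differentiability there. *)
Definition holomorphic_on_polydisc f : Prop :=
  forall z, polydisc z -> differentiable f z.

Definition partial (j : 'I_n) f : 'rV[C]_n -> C := 'D_(delta_mx ord0 j) f.

Definition mobius w z : 'rV[C]_n :=
  \row_j ((z ord0 j + w ord0 j) / (1 + (w ord0 j)^* * z ord0 j)).

Definition peschl_g f w : 'rV[C]_n -> C := fun z =>
  (f (mobius w z) - f w) / (1 - (f w)^* * f (mobius w z)).

Definition D1 f w : C := \sum_(j < n) partial j (peschl_g f w) 0.

Definition D2 f w : C :=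
  \sum_(j < n) partial j (partial j (peschl_g f w)) 0
  + 2 * \sum_(j < n) \sum_(k < n | (j < k)%N)
          partial j (partial k (peschl_g f w)) 0.

End Defs.

(* Main.v *)
Require Import Defs.
From mathcomp Require Import all_boot all_order all_algebra.
From mathcomp Require Import complex.
From mathcomp Require Import boolp classical_sets reals topology normedtype.
From mathcomp Require Import derive functions.
From mathcomp Require Import ring lra zify.

(** Let g = peschl_g f w and let phi(s) = g(s, ..., s) be its restriction to
    the diagonal. By the invariance of the disc under its
    automorphisms, phi maps the unit disc into itself and fixes 0. The chain
    rule gives phi'(0) = D1 f w, and phi''(0) is the sum of all second partial
    derivatives of g at 0, which is D2 f w because mixed derivatives commute
    ([mixed_derivatives], [diagonal_second_derivative]). The claim is thus the
    one-variable inequality |a2| <= 1 - |a1|^2 for the coefficients of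
    phi(s) = a1 s + a2 s^2 + ... ([second_coeff_le]).

    That inequality is an instance of Bessel's inequality on the circle of
    radius r < 1. For F(t) = phi(t) (1/t + c), the coefficients of 1 and t are
    a1 and a2 + c a1, and |F(t)| <= |1/t + c|, hence
      |a1|^2 + r^2 |a2 + c a1|^2 <= 1/r^2 + |c|^2.
    Choosing |c| = |a1| so that a2 and c a1 have the same argument and letting
    r tend to 1 gives (|a2| + |a1|^2)^2 <= 1.

    Only the existence of first derivatives is assumed, so the existence of
    the second ones, and the identification of a1 and a2 with mean values on
    circles, rest on Cauchy's theorem. It is proved here for finite sums
    instead of integrals:
    - A segment carries trapezoid sums obtained by repeated bisection. They
      are antisymmetric and exactly additive at midpoints, so the sums over a
      triangle split exactly into those over its four half-size parts, and
      bisection shows that they tend to 0 ([goursat]); one exceptional vertex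
      is allowed ([tri_null_corner]).
    - The circle is replaced by the orbit t_k = r w^k of a root of unity w
      close to 1. The triangles (p, t_k, t_(k+1)) fill the polygon, their
      inner edges cancel, and Cauchy's formula appears as: the mean over the
      orbit of t (f t - f p) / (t - p) is small ([circle_cauchy]).
    - Expanding t / (t - p) in powers of p / t gives the Taylor expansion of f
      with coefficients that are limits of means ([taylor_mean],
      [taylor_order2]), with uniform bounds on the remainders. The uniformity
      turns difference quotients in one variable into uniformly convergent
      families of holomorphic functions of the other one, which yields the
      mixed derivatives ([cdiff_mixed]). *)

Set Implicit Arguments.
Unset Strict Implicit.
Unset Printing Implicit Defensive.

Import Order.TTheory GRing.Theory Num.Theory.
Import numFieldNormedType.Exports.
Import ComplexField.Normc.

Local Open Scope ring_scope.

(** * The modulus as a real number *)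

Section Modulus.
Context {R : realType}.
Local Notation C := R[i].
Local Notation N := (@normc R).
Implicit Types x y z : C.

Lemma normr_normc z : `|z| = (N z)%:C%C.
Proof. by rewrite normc_def; case: z. Qed.

Lemma normc_ge0 z : 0 <= N z.
Proof. by rewrite -lecR -normr_normc normr_ge0. Qed.

Lemma normcD_le x y : N (x + y) <= N x + N y.
Proof. exact: le_normcD. Qed.

Lemma normc_opp x : N (- x) = N x.
Proof. exact: normcN. Qed.

Lemma normcB_le x y : N (x - y) <= N x + N y.
Proof. by rewrite -(normc_opp y) normcD_le. Qed.

Lemma normc_distC x y : N (x - y) = N (y - x).
Proof. by rewrite -normc_opp opprB. Qed.

Lemma normc_triangle z x y : N (x - y) <= N (x - z) + N (z - y).
Proof. by have := normcD_le (x - z) (z - y); rewrite subrKA. Qed.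

Lemma normc_eq0 x : (N x == 0) = (x == 0).
Proof. by apply/eqP/eqP => [/eq0_normc //|->]; apply: normc0. Qed.

Lemma normc_gt0 x : (0 < N x) = (x != 0).
Proof. by rewrite lt_def normc_ge0 andbT normc_eq0. Qed.

Lemma normcX x n : N (x ^+ n) = N x ^+ n.
Proof. by elim: n => [|n IH]; rewrite ?expr0 ?normc1// !exprS normcM IH. Qed.

Lemma normc_real (r : R) : N r%:C%C = `|r|.
Proof. by rewrite /normc /= expr0n /= addr0 sqrtr_sqr. Qed.

Lemma normc_nat n : N n%:R = n%:R.
Proof.
by rewrite -[n%:R in LHS](rmorph_nat (real_complex R)) normc_real ger0_norm.
Qed.

Lemma normc_half x : N (x / 2) = N x / 2.
Proof. by rewrite normcM normcV (normc_nat 2). Qed.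

Lemma normc_sum (I : Type) (s : seq I) (F : I -> C) :
  N (\sum_(i <- s) F i) <= \sum_(i <- s) N (F i).
Proof.
elim: s => [|i s IH]; first by rewrite !big_nil normc0.
by rewrite !big_cons; apply: le_trans (normcD_le _ _) _; rewrite lerD2l.
Qed.

Lemma Re_half z : complex.Re (z / 2) = complex.Re z / 2.
Proof.
have -> : (2 : C)^-1 = (2^-1)%:C%C by rewrite fmorphV rmorph_nat.
by case: z => x y /=; rewrite mulr0 subr0.
Qed.

Lemma ReD x y : complex.Re (x + y) = complex.Re x + complex.Re y.
Proof. by case: x; case: y. Qed.

Lemma Re_le_normc z : `|complex.Re z| <= N z.
Proof. by rewrite -lecR -normr_normc normc_ge_Re. Qed.

Lemma Im_le_normc z : `|complex.Im z| <= N z.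
Proof.
by case: z => a b; rewrite /= -sqrtr_sqr ler_wsqrtr // lerDr sqr_ge0.
Qed.

Lemma normc_le_ReIm z : N z <= `|complex.Re z| + `|complex.Im z|.
Proof.
case: z => a b /=; rewrite -[leRHS]ger0_norm ?addr_ge0//.
rewrite -sqrtr_sqr ler_wsqrtr // sqrrD !real_normK ?num_real//.
by rewrite -addrA lerD2l lerDr mulrn_wge0 // mulr_ge0.
Qed.

End Modulus.

(** * Trapezoid sums along segments and triangles *)
Section TrapezoidSums.
Context {R : realType}.
Local Notation C := R[i].
Local Notation N := (@normc R).
Implicit Types (D : set C) (H G : C -> C) (a b c z : C).

(** Bisection makes the sums of level n + 1 split exactly at the midpoint, and
    the trapezoid rule at level 0 makes them antisymmetric and exact on affine
    functions; these three identities replace the corresponding properties of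
    the line integral. *)
Fixpoint trap H n a b : C :=
  if n is m.+1 then trap H m a ((a + b) / 2) + trap H m ((a + b) / 2) b
  else (b - a) * (H a + H b) / 2.

Lemma trapC H n a b : trap H n b a = - trap H n a b.
Proof.
elim: n a b => [|n IH] a b /=; first by ring.
by rewrite [b + a]addrC (IH a) (IH _ b); ring.
Qed.

Lemma trapD H G n a b :
  trap (fun z => H z + G z) n a b = trap H n a b + trap G n a b.
Proof. by elim: n a b => [|n IH] a b /=; rewrite ?IH; ring. Qed.

Lemma trap_affine u v n a b :
  trap (fun z => u + v * z) n a b = u * (b - a) + v * (b ^+ 2 - a ^+ 2) / 2.
Proof. by elim: n a b => [|n IH] a b /=; rewrite ?IH; field. Qed.

(** The sums only sample dyadic points of a segment, so this is all the
    convexity that the estimates need. *)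
Definition midclosed D := forall a b, D a -> D b -> D ((a + b) / 2).

Lemma sub_mid a b : (a + b) / 2 - a = (b - a) / 2.
Proof. by field. Qed.

Lemma mid_sub a b : b - (a + b) / 2 = (b - a) / 2.
Proof. by field. Qed.

Lemma trap_le H D M n a b : midclosed D -> (forall z, D z -> N (H z) <= M) ->
  D a -> D b -> N (trap H n a b) <= M * N (b - a).
Proof.
move=> Dm HM; elim: n a b => [|n IH] a b Da Db /=.
  rewrite -mulrA normcM [leRHS]mulrC ler_wpM2l ?normc_ge0 // normc_half.
  have := normcD_le (H a) (H b); have := HM _ Da; have := HM _ Db; lra.
have Dab := Dm _ _ Da Db.
have := normcD_le (trap H n a ((a + b) / 2)) (trap H n ((a + b) / 2) b).
have := IH _ _ Da Dab; have := IH _ _ Dab Db.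
rewrite sub_mid mid_sub normc_half; lra.
Qed.

(** The sums of the affine part telescope, so only the deviation from it has
    to be estimated. *)
Lemma trap_near_affine H D u v e n a b : midclosed D ->
  (forall z, D z -> N (H z - (u + v * z)) <= e) -> D a -> D b ->
  N (trap H n a b - (u * (b - a) + v * (b ^+ 2 - a ^+ 2) / 2))
    <= e * N (b - a).
Proof.
move=> Dm He Da Db; rewrite -(trap_affine u v n).
pose G z := H z - (u + v * z).
have -> : H = fun z => G z + (u + v * z) by apply/funext=> z; rewrite subrK.
by rewrite trapD addrK; exact: trap_le Dm He Da Db.
Qed.

Definition tri H n a b c := trap H n a b + trap H n b c + trap H n c a.

Definition perim a b c := N (b - a) + N (c - b) + N (a - c).

(** The inner edges are traversed in both directions and cancel. *)
Lemma tri_split H n a b c : tri H n.+1 a b c =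
  tri H n a ((a + b) / 2) ((c + a) / 2)
  + tri H n ((a + b) / 2) b ((b + c) / 2)
  + tri H n ((c + a) / 2) ((b + c) / 2) c
  + tri H n ((a + b) / 2) ((b + c) / 2) ((c + a) / 2).
Proof.
rewrite /tri /= (trapC H n ((c + a) / 2) ((b + c) / 2)).
rewrite (trapC H n ((a + b) / 2) ((b + c) / 2)).
by rewrite (trapC H n ((a + b) / 2) ((c + a) / 2)); ring.
Qed.

(** The primitive of the affine part takes the same value at both ends of
    the closed contour. *)
Lemma tri_near_affine H D u v e n a b c : midclosed D ->
  (forall z, D z -> N (H z - (u + v * z)) <= e) -> D a -> D b -> D c ->
  N (tri H n a b c) <= e * perim a b c.
Proof.
move=> Dm He Da Db Dc.
have E p q (Dp : D p) (Dq : D q) := trap_near_affine n Dm He Dp Dq.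
set X := fun p q : C => u * (q - p) + v * (q ^+ 2 - p ^+ 2) / 2.
have -> : tri H n a b c = (trap H n a b - X a b) + (trap H n b c - X b c)
   + (trap H n c a - X c a) by rewrite /tri /X; field.
have := normcD_le (trap H n a b - X a b + (trap H n b c - X b c))
  (trap H n c a - X c a).
have := normcD_le (trap H n a b - X a b) (trap H n b c - X b c).
have := E _ _ Da Db; have := E _ _ Db Dc; have := E _ _ Dc Da.
rewrite /perim -/(X a b) -/(X b c) -/(X c a); lra.
Qed.

Lemma tri_le H D M n a b c : midclosed D -> (forall z, D z -> N (H z) <= M) ->
  D a -> D b -> D c -> N (tri H n a b c) <= M * perim a b c.
Proof.
move=> Dm HM; apply: (@tri_near_affine H D 0 0) => // z Dz.
by rewrite mul0r addr0 subr0 HM.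
Qed.

End TrapezoidSums.

(** * Goursat's lemma *)

Section Goursat.
Context {R : realType}.
Local Notation C := R[i].
Local Notation N := (@normc R).
Implicit Types (D : set C) (H G : C -> C) (a b c z : C).

(** The intervals of radius 2K / 2^k around u k are nested, so the supremum
    of their left ends lies in all of them. *)
Lemma real_geometric_cvg (K : R) (u : nat -> R) :
  (forall k, `|u k.+1 - u k| <= K / 2 ^+ k) ->
  exists l, forall k, `|u k - l| <= 2 * K / 2 ^+ k.
Proof.
move=> uK.
have p2 k : (2 : R) ^+ k != 0 by rewrite expf_neq0 // pnatr_eq0.
have E k : 2 * K / 2 ^+ k.+1 = K / 2 ^+ k by rewrite exprS; field; exact: p2.
have lo k : u k - 2 * K / 2 ^+ k <= u k.+1 - 2 * K / 2 ^+ k.+1.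
  by have := uK k; rewrite E ler_norml => /andP[]; lra.
have up k : u k.+1 + 2 * K / 2 ^+ k.+1 <= u k + 2 * K / 2 ^+ k.
  by have := uK k; rewrite E ler_norml => /andP[]; lra.
have Kge k : 0 <= K / 2 ^+ k by apply: le_trans (uK k).
have lo_le j k : (j <= k)%N -> u j - 2 * K / 2 ^+ j <= u k - 2 * K / 2 ^+ k.
  by move=> /subnK <-; elim: (k - j)%N => // m IH; apply: le_trans IH (lo _).
have up_le j k : (j <= k)%N -> u k + 2 * K / 2 ^+ k <= u j + 2 * K / 2 ^+ j.
  by move=> /subnK <-; elim: (k - j)%N => // m IH; apply: le_trans (up _) IH.
have cross j k : u j - 2 * K / 2 ^+ j <= u k + 2 * K / 2 ^+ k.
  case: (leqP j k) => [/lo_le|/ltnW /up_le]; have := Kge j; have := Kge k; lra.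
pose A : set R := [set x | exists j, x = u j - 2 * K / 2 ^+ j]%classic.
have A0 : A (u 0%N - 2 * K / 2 ^+ 0) by exists 0%N.
have Aub k : ubound A (u k + 2 * K / 2 ^+ k) by move=> _ [j ->]; exact: cross.
exists (sup A) => k; rewrite ler_norml; apply/andP; split.
  have : sup A <= u k + 2 * K / 2 ^+ k by apply: ge_sup => //; eexists; exact: A0.
  lra.
have : u k - 2 * K / 2 ^+ k <= sup A.
  by apply: ub_le_sup; [exists (u 0%N + 2 * K / 2 ^+ 0); exact: Aub|exists k].
lra.
Qed.

Lemma geometric_cvg (K : R) (u : nat -> C) :
  (forall k, N (u k.+1 - u k) <= K / 2 ^+ k) ->
  exists l, forall k, N (u k - l) <= 4 * K / 2 ^+ k.
Proof.
move=> uK.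
have [k|x xP] := @real_geometric_cvg K (fun k => complex.Re (u k)).
  rewrite -raddfB; exact: le_trans (Re_le_normc _) (uK k).
have [k|y yP] := @real_geometric_cvg K (fun k => complex.Im (u k)).
  rewrite -raddfB; exact: le_trans (Im_le_normc _) (uK k).
exists (x +i* y)%C => k.
have := normc_le_ReIm (u k - (x +i* y)%C); rewrite !raddfB /=.
have := xP k; have := yP k; lra.
Qed.

Definition cdiff (f : C -> C) z a := forall e : R, 0 < e ->
  exists2 d : R, 0 < d & forall h, N h < d ->
    N (f (z + h) - f z - a * h) <= e * N h.

Lemma ball_midclosed z (r : R) : midclosed [set w | N (w - z) <= r]%classic.
Proof.
move=> a b /= za zb; have -> : (a + b) / 2 - z = ((a - z) + (b - z)) / 2.
  by field.
have := normcD_le (a - z) (b - z); rewrite normc_half; lra.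
Qed.

(** Near a point of differentiability the function is affine up to an error
    that is small relative to the distance. *)
Lemma tri_local H z u : cdiff H z u -> forall e : R, 0 < e ->
  exists2 d : R, 0 < d & forall (r : R) a b c n, r < d ->
    N (a - z) <= r -> N (b - z) <= r -> N (c - z) <= r ->
    N (tri H n a b c) <= e * r * perim a b c.
Proof.
move=> Hz e e0; have [d d0 dP] := Hz e e0.
exists d => // r a b c n rd ar br cr.
apply: (tri_near_affine n (@ball_midclosed z r) (u := H z - u * z) (v := u))
  => // w /= wr.
have := dP (w - z) (le_lt_trans wr rd); rewrite [z + _]addrC subrK.
have -> : H w - (H z - u * z + u * w) = H w - H z - u * (w - z) by ring.
move=> /le_trans -> //; rewrite ler_pM2l //.
Qed.

(** The discrete form of a vanishing contour integral. *)
Definition tri_null H a b c := forall e : R, 0 < e ->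
  exists n0, forall n, (n0 <= n)%N -> N (tri H n a b c) <= e.

Definition seqclosed D := forall z,
  (forall e : R, 0 < e -> exists2 w, D w & N (w - z) < e) -> D z.

Lemma half_pow_small (K e : R) : 0 < e -> exists k, K / 2 ^+ k < e.
Proof.
move=> e0; have [m mP] : exists m : nat, K / e < m%:R.
  by exists (Num.truncn `|K / e|).+1; apply: le_lt_trans (ler_norm _)
    (truncnS_gt _).
exists m; rewrite ltr_pdivrMr ?exprn_gt0 // mulrC -ltr_pdivrMr //.
apply: lt_le_trans mP _.
by rewrite -natrX ler_nat ltnW // ltn_expl.
Qed.

(** What bisection propagates, for a triangle t whose perimeter is at most p:
    the bound is quadratic in p, so those of the four half-size parts add up
    to the one of the whole. *)
Definition small_sums H (e : R) (t : C * C * C) (p : R) := exists n0, forall n,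
  (n0 <= n)%N -> N (tri H n t.1.1 t.1.2 t.2) <= e * p ^+ 2.

Lemma leq_add4 n0 n1 n2 n3 n : (n0 + n1 + n2 + n3 <= n)%N ->
  [/\ (n0 <= n)%N, (n1 <= n)%N, (n2 <= n)%N & (n3 <= n)%N].
Proof. by move=> nn; split; lia. Qed.

Lemma small_sums_children H (e p : R) a b c :
  small_sums H e (a, (a + b) / 2, (c + a) / 2) (p / 2) ->
  small_sums H e ((a + b) / 2, b, (b + c) / 2) (p / 2) ->
  small_sums H e ((c + a) / 2, (b + c) / 2, c) (p / 2) ->
  small_sums H e ((a + b) / 2, (b + c) / 2, (c + a) / 2) (p / 2) ->
  small_sums H e (a, b, c) p.
Proof.
move=> [n1 P1] [n2 P2] [n3 P3] [n4 P4].
exists (n1 + n2 + n3 + n4).+1 => -[//|n] nn.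
rewrite /= tri_split; have [/P1 + /P2 + /P3 + /P4] := leq_add4 nn.
rewrite /=.
set t1 := tri H n a _ _; set t2 := tri H n _ b _.
set t3 := tri H n _ _ c; set t4 := tri H n _ _ _.
have -> : e * (p / 2) ^+ 2 = e * p ^+ 2 / 4 by field.
have := normcD_le (t1 + t2 + t3) t4; have := normcD_le (t1 + t2) t3.
have := normcD_le t1 t2; lra.
Qed.

Lemma perim_children a b c :
  [/\ perim a ((a + b) / 2) ((c + a) / 2) = perim a b c / 2,
      perim ((a + b) / 2) b ((b + c) / 2) = perim a b c / 2,
      perim ((c + a) / 2) ((b + c) / 2) c = perim a b c / 2
    & perim ((a + b) / 2) ((b + c) / 2) ((c + a) / 2) = perim a b c / 2].
Proof.
rewrite /perim !sub_mid !mid_sub.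
have -> : (c + a) / 2 - (a + b) / 2 = (c - b) / 2 by field.
have -> : (b + c) / 2 - (a + b) / 2 = (c - a) / 2 by field.
have -> : (a + b) / 2 - (b + c) / 2 = (a - c) / 2 by field.
have -> : (b + c) / 2 - (c + a) / 2 = (b - a) / 2 by field.
have -> : (c + a) / 2 - (b + c) / 2 = (a - b) / 2 by field.
have -> : (a + b) / 2 - (c + a) / 2 = (b - c) / 2 by field.
rewrite !normc_half [N (c - a)]normc_distC [N (a - b)]normc_distC.
by rewrite [N (b - c)]normc_distC; split; ring.
Qed.

(** If the sums of a triangle are not small, neither are those of one of its
    half-size parts. The triangles selected in this way shrink to a point of
    D, where differentiability makes the sums small. *)
Lemma goursat D H a b c : midclosed D -> seqclosed D ->
  (forall z, D z -> exists u, cdiff H z u) ->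
  D a -> D b -> D c -> tri_null H a b c.
Proof.
move=> Dm Dcl Hd Da Db Dc e e0.
(* Adding 1 keeps the bound positive for degenerate triangles. *)
pose p0 := perim a b c + 1.
have p0_ge1 : 1 <= p0.
  by rewrite /p0 /perim; have := normc_ge0 (b - a); have := normc_ge0 (c - b);
     have := normc_ge0 (a - c); lra.
have p00 : 0 < p0 by lra.
pose e1 := e / p0 ^+ 2.
have e10 : 0 < e1 by rewrite divr_gt0 // exprn_gt0.
suff [n0 n0P] : small_sums H e1 (a, b, c) p0.
  exists n0 => n /n0P /=; rewrite divfK // expf_neq0 //; lra.
apply: contrapT => nsm.
pose in_D (t : C * C * C) := [/\ D t.1.1, D t.1.2 & D t.2].
pose per (t : C * C * C) := perim t.1.1 t.1.2 t.2.
pose bad (x : (C * C * C) * R) :=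
  [/\ in_D x.1, per x.1 <= x.2 & ~ small_sums H e1 x.1 x.2].
have nextE (x : (C * C * C) * R) : exists y, bad x ->
    [/\ bad y, y.2 = x.2 / 2 & N (y.1.1.1 - x.1.1.1) <= x.2].
  case: x => -[[x y] z] p.
  have [|nbad] := EM (bad (x, y, z, p)); last by exists (x, y, z, p).
  move=> [[/= Dx Dy Dz] pp nb].
  have [pe1 pe2 pe3 pe4] := perim_children x y z.
  have Dxy := Dm _ _ Dx Dy; have Dyz := Dm _ _ Dy Dz; have Dzx := Dm _ _ Dz Dx.
  rewrite /per /= in pp.
  have ple : perim x y z / 2 <= p / 2 by lra.
  have [d1 d2] : N ((x + y) / 2 - x) <= p /\ N ((z + x) / 2 - x) <= p.
    have := normc_ge0 (y - x); have := normc_ge0 (z - y).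
    have := normc_ge0 (x - z); move: pp.
    rewrite /perim sub_mid addrC normc_half.
    rewrite [X in _ <= _ /\ X <= _]normc_distC [z + x]addrC [x + z]addrC mid_sub.
    rewrite normc_half => ? ? ? ?; split; lra.
  have d0 : N (x - x) <= p by rewrite subrr normc0; have := normc_ge0 ((x + y)
    / 2 - x); lra.
  apply: contrapT => none; apply: nb; apply: small_sums_children.
  - apply: contrapT => nb; apply: none.
    by exists (x, (x + y) / 2, (z + x) / 2, p / 2) => _; split=> //; split=>
      //; rewrite /per /= pe1.
  - apply: contrapT => nb; apply: none.
    by exists ((x + y) / 2, y, (y + z) / 2, p / 2) => _; split=> //; split=>
      //; rewrite /per /= pe2.
  - apply: contrapT => nb; apply: none.
    by exists ((z + x) / 2, (y + z) / 2, z, p / 2) => _; split=> //; split=>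
      //; rewrite /per /= pe3.
  - apply: contrapT => nb; apply: none.
    by exists ((x + y) / 2, (y + z) / 2, (z + x) / 2, p / 2) => _; split=> //;
      split=> //; rewrite /per /= pe4.
have [next nextP] := boolp.choice nextE.
pose s k := iter k next (a, b, c, p0).
have sbad k : bad (s k).
  elim: k => [|k /nextP[]//]; split=> //=; rewrite /per /p0 /=; lra.
have sp k : (s k).2 = p0 / 2 ^+ k.
  elim: k => [|k IH]; first by rewrite divr1.
  have [_ /= -> _] := nextP _ (sbad k); rewrite IH exprS invfM.
  by rewrite mulrCA mulrC.
have [z zP] : exists z, forall k, N ((s k).1.1.1 - z) <= 4 * p0 / 2 ^+ k.
  apply: geometric_cvg => k; rewrite -sp.
  by have [_ _] := nextP _ (sbad k).
have Dz : D z.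
  apply: Dcl => d d0; have [k kP] := half_pow_small (4 * p0) d0.
  by exists (s k).1.1.1; [have [[]] := sbad k|apply: le_lt_trans kP].
have [u uz] := Hd _ Dz.
(* 5 p bounds the distance from the limit point to all three vertices: 4 p to
   the first one, and p along a side. *)
have [d d0 dP] := tri_local uz (divr_gt0 e10 (ltr0n _ 5)).
have [k kP] := half_pow_small (5 * p0) d0.
have [[D1 D2 D3] pk nb] := sbad k; apply: nb; exists 0%N => n _.
have zk := zP k; have sk := sp k; rewrite /per in pk.
set x := (s k).1.1.1 in zk pk *; set y := (s k).1.1.2 in pk *.
set w := (s k).1.2 in pk *; set p := (s k).2 in sk pk *.
rewrite -mulrA -sk in zk; rewrite -mulrA -sk in kP.
have [yx xw] : N (y - x) <= p /\ N (w - x) <= p.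
  move: pk; rewrite /perim; have := normc_ge0 (y - x); have := normc_ge0 (w - y).
  by have := normc_ge0 (x - w); rewrite [N (w - x)]normc_distC; split; lra.
have yz : N (y - z) <= 5 * p by have := normc_triangle x y z; lra.
have wz : N (w - z) <= 5 * p by have := normc_triangle x w z; lra.
have p_ge0 : 0 <= p by have := normc_ge0 (y - x); lra.
have xz : N (x - z) <= 5 * p by lra.
apply: le_trans (dP _ _ _ _ n kP xz yz wz) _.
have -> : e1 * p ^+ 2 = e1 / 5 * (5 * p) * p by field.
apply: ler_wpM2l => //.
have -> : e1 / 5 * (5 * p) = e1 * p by field.
exact: mulr_ge0 (ltW e10) p_ge0.
Qed.

End Goursat.

(** * Triangles with an exceptional vertex *)

Section CornerTriangle.
Context {R : realType}.
Local Notation C := R[i].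
Local Notation N := (@normc R).
Implicit Types (D : set C) (H G : C -> C) (a b c z : C).

Definition cdisc (r : R) : set C := [set z | N z <= r]%classic.

Lemma cdisc_midclosed r : midclosed (cdisc r).
Proof.
by move=> a b; rewrite /cdisc /= normc_half; have := normcD_le a b; lra.
Qed.

Lemma cdisc_seqclosed r : seqclosed (cdisc r).
Proof.
move=> z zP; rewrite /cdisc /=; apply/ler_addgt0Pr => e /zP[w /= wr wz].
have := normcD_le (z - w) w; rewrite subrK normc_distC; rewrite /cdisc/= in wr; lra.
Qed.

(** The half-plane keeps a triangle away from the exceptional vertex p. *)
Lemma cdisc_halfplane (r s : R) (k p : C) :
  let D := [set z | cdisc r z /\ s <= complex.Re (k * (z - p))]%classic in
  midclosed D /\ seqclosed D.
Proof.
move=> D; split=> [a b [ra sa] [rb sb]|z zP]; split.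
- exact: cdisc_midclosed.
- have -> : k * ((a + b) / 2 - p) = (k * (a - p)) / 2 + (k * (b - p)) / 2.
    by field.
  rewrite ReD !Re_half; lra.
- by apply: cdisc_seqclosed => e /zP[w [rw _]] we; exists w.
- apply/ler_addgt0Pr => e e0.
  have k0 : 0 < N k + 1 by have := normc_ge0 k; lra.
  have [w [_ sw] we] := zP _ (divr_gt0 e0 k0).
  have := Re_le_normc (k * (z - p) - k * (w - p)); rewrite raddfB ler_norml.
  have -> : k * (z - p) - k * (w - p) = k * (z - w) by ring.
  rewrite normcM normc_distC => /andP[+ _].
  have : N k * N (w - z) <= e.
    have : N (w - z) * (N k + 1) <= e by rewrite -ler_pdivlMr // ltW.
    have := normc_ge0 (w - z); lra.
  lra.
Qed.

(** Three of the four half-size parts avoid p and are covered by Goursat's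
    lemma. The fourth has half the perimeter, so after j bisections its sums
    are bounded by M times the perimeter over 2^j. *)
Lemma tri_null_corner H (M r : R) p b c (k : C) (s : R) :
  (forall z, cdisc r z -> N (H z) <= M) ->
  (forall z, cdisc r z -> z != p -> exists u, cdiff H z u) ->
  cdisc r p -> cdisc r b -> cdisc r c -> 0 < s ->
  s <= complex.Re (k * (b - p)) -> s <= complex.Re (k * (c - p)) ->
  tri_null H p b c.
Proof.
move=> HM Hd rp rb rc s0 sb sc.
suff shrink j : forall e : R, 0 < e -> exists n0, forall n, (n0 <= n)%N ->
    N (tri H n p b c) <= e + M * perim p b c / 2 ^+ j.
  move=> e e0; have [j jP] := half_pow_small (M * perim p b c) (divr_gt0 e0
    (ltr0n _ 2)).
  have [n0 n0P] := shrink j _ (divr_gt0 e0 (ltr0n _ 2)).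
  by exists n0 => n /n0P; lra.
elim: j b c s rb rc s0 sb sc => [|j IH] b c s rb rc s0 sb sc e e0.
  exists 0%N => n _; rewrite divr1.
  by have := tri_le n (@cdisc_midclosed r) HM rp rb rc; lra.
have sb' : s / 2 <= complex.Re (k * ((p + b) / 2 - p)).
  by rewrite sub_mid mulrA Re_half; lra.
have sc' : s / 2 <= complex.Re (k * ((c + p) / 2 - p)).
  by rewrite [c + p]addrC sub_mid mulrA Re_half; lra.
have rpb := cdisc_midclosed rp rb; have rcp := cdisc_midclosed rc rp.
have [n0 n0P] := IH _ _ _ rpb rcp (divr_gt0 s0 (ltr0n _ 2)) sb' sc' _
  (divr_gt0 e0 (ltr0n _ 4)).
have [Dm Dcl] := cdisc_halfplane r (s / 2) k p.
have Hd' z : cdisc r z /\ s / 2 <= complex.Re (k * (z - p)) ->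
    exists u, cdiff H z u.
  move=> [rz sz]; apply: Hd => //; apply/eqP => zp; move: sz.
  by rewrite zp subrr mulr0 /=; lra.
have sb2 : s / 2 <= complex.Re (k * (b - p)) by lra.
have sc2 : s / 2 <= complex.Re (k * (c - p)) by lra.
have Dbc := Dm _ _ (conj rb sb2) (conj rc sc2).
have e4 := divr_gt0 e0 (ltr0n R 4).
have [n1 P1] := goursat Dm Dcl Hd' (conj rpb sb') (conj rb sb2) Dbc e4.
have [n2 P2] := goursat Dm Dcl Hd' (conj rcp sc') Dbc (conj rc sc2) e4.
have [n3 P3] := goursat Dm Dcl Hd' (conj rpb sb') Dbc (conj rcp sc') e4.
exists (n0 + n1 + n2 + n3).+1 => -[//|n] nn; rewrite tri_split.
have [/n0P + /P1 + /P2 + /P3] := leq_add4 nn.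
have [-> _ _ _] := perim_children p b c.
set t0 := tri H n p _ _; set t1 := tri H n _ b _.
set t2 := tri H n _ _ c; set t3 := tri H n _ _ _.
have -> : M * (perim p b c / 2) / 2 ^+ j = M * perim p b c / 2 ^+ j.+1.
  by rewrite exprS; field; rewrite expf_neq0 // pnatr_eq0.
have := normcD_le (t0 + t1 + t2) t3; have := normcD_le (t0 + t1) t2.
have := normcD_le t0 t1; lra.
Qed.

End CornerTriangle.

(** * Circles and roots of unity *)

Section CircleCauchy.
Local Open Scope classical_set_scope.
Context {R : realType}.
Local Notation C := R[i].
Local Notation N := (@normc R).
Implicit Types (f H : C -> C) (a b c p t w z : C).

Definition ccont f t := forall e : R, 0 < e ->
  exists2 d : R, 0 < d & forall z, N (z - t) < d -> N (f z - f t) <= e.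

Lemma cdiff_ccont f z a : cdiff f z a -> ccont f z.
Proof.
move=> fz e e0; have [d d0 dP] := fz 1 ltr01.
have K0 : 0 < 1 + N a by have := normc_ge0 a; lra.
exists (Num.min d (e / (1 + N a))).
  by rewrite lt_min d0 divr_gt0.
move=> w; rewrite lt_min => /andP[/dP]; rewrite [z + _]addrC subrK mul1r => wd.
rewrite ltr_pdivlMr // => we.
have := normcD_le (f w - f z - a * (w - z)) (a * (w - z)).
rewrite subrK normcM; lra.
Qed.

(** Compactness of the square around the circle; near a point off the circle
    there is nothing to prove. *)
Lemma circle_unif_cont f (r : R) : (forall t, N t = r -> ccont f t) ->
  forall e : R, 0 < e -> exists2 d : R, 0 < d & forall t, N t = r ->
    forall z, N (z - t) < d -> N (f z - f t) <= e.
Proof.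
move=> fc e e0.
pose P (d : R) (x : R * R) := N (x.1 +i* x.2)%C = r ->
  forall z, N (z - (x.1 +i* x.2)%C) < d -> N (f z - f (x.1 +i* x.2)%C) <= e.
have cpt : compact ((`[- r, r] `*` `[- r, r]) : set (R * R))%classic.
  by apply: compact_setX; exact: segment_compact.
have near_ball (x : R * R) (d : R) : 0 < d ->
    \forall x' \near x, N ((x'.1 +i* x'.2)%C - (x.1 +i* x.2)%C) < d.
  move=> d0; apply/nbhs_ballP; exists (d / 2) => /=; first by lra.
  move=> [y1 y2] [/= b1 b2]; rewrite /ball /= in b1 b2.
  have := normc_le_ReIm ((y1 +i* y2)%C - (x.1 +i* x.2)%C).
  by move: b1 b2; case: x => x1 x2 /=; rewrite ![`|_ - y1|]distrC ![`|_ -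
    y2|]distrC; lra.
have : \forall d \near 0^'+, ((`[- r, r] `*` `[- r, r]) `<=` P d)%classic.
  apply: ((compact_near_coveringP _).1 cpt) => -[x1 x2] _.
  have [xr|xr] := eqVneq (N (x1 +i* x2)%C) r.
    have [d d0 dP] := fc _ xr _ (divr_gt0 e0 (ltr0n _ 2)).
    have d20 : 0 < d / 2 by lra.
    near=> x' d' => /= x'r z zd.
    have x'x : N ((x'.1 +i* x'.2)%C - (x1 +i* x2)%C) < d / 2.
      by near: x'; exact: (near_ball (x1, x2)).
    have d'd : d' < d / 2 by near: d'; exact: nbhs_right_lt.
    have := normc_triangle (f (x1 +i* x2)%C) (f z) (f (x'.1 +i* x'.2)%C).
    have := dP (x'.1 +i* x'.2)%C ltac:(lra).
    rewrite normc_distC.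
    have := normc_triangle (x'.1 +i* x'.2)%C z (x1 +i* x2)%C => zx.
    have := dP z ltac:(lra); lra.
  have g0 : 0 < `|N (x1 +i* x2)%C - r| by rewrite normr_gt0 subr_eq0.
  near=> x' d' => /= x'r.
  have : N ((x'.1 +i* x'.2)%C - (x1 +i* x2)%C) < `|N (x1 +i* x2)%C - r|.
    by near: x'; exact: (near_ball (x1, x2)).
  set y := (x'.1 +i* x'.2)%C in x'r *; set x := (x1 +i* x2)%C.
  have := normcD_le (y - x) x; have := normcD_le (x - y) y.
  rewrite !subrK [N (x - y)]normc_distC x'r.
  have := ler_norm (N x - r); have := ler_norm (r - N x).
  by case: (lerP 0 (N x - r)) => h1 h2 h3 h4 h5; [rewrite (ger0_norm
    h1)|rewrite (ltr0_norm h1)]; lra.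
move=> nd.
have [d [d0 dP]] : exists d : R, 0 < d /\
    ((`[- r, r] `*` `[- r, r]) `<=` P d)%classic.
  have : \forall d \near 0^'+, (0 < d :> R) /\
      ((`[- r, r] `*` `[- r, r]) `<=` P d)%classic.
    near=> d; split; first by near: d; exact: nbhs_right_gt.
    by near: d.
  move=> /(@filter_ex _ _ (at_right_proper_filter (0:R)))[d []]; by exists d.
exists d => // -[x y] tr z zd; apply: (dP (x, y)) => //=.
split; rewrite /= in_itv /= -ler_norml -tr.
  exact: (Re_le_normc (x +i* y)%C).
exact: (Im_le_normc (x +i* y)%C).
Unshelve. all: by end_near. Qed.

Definition unity_root (n : nat) w := [/\ (0 < n)%N, w ^+ n = 1, w != 1 & N w = 1].

(** Successive square roots of -1: if v is the square root of w
    in the right half-plane, then |v - 1| = |w - 1| / |v + 1| and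
    |v + 1| >= 4/3. *)
Lemma unity_root_near1 (d : R) : 0 < d ->
  exists n w, unity_root n w /\ N (w - 1) < d.
Proof.
move=> d0.
suff H k : exists n w, unity_root n w /\ N (w - 1) <= 2 / (4 / 3) ^+ k.
  have bernoulli k : 1 + k%:R / 3 <= (4 / 3 : R) ^+ k.
    elim: k => [|k IH]; first by rewrite expr0; lra.
    rewrite exprS; have k0 : 0 <= k%:R :> R by []; rewrite -natr1; nra.
  have [k kd] : exists k : nat, 6 / d < k%:R.
    by exists (Num.truncn (6 / d)).+1; exact: truncnS_gt.
  have [n [w [wr wk]]] := H k; exists n, w; split=> //; apply: le_lt_trans wk _.
  rewrite ltr_pdivrMr ?exprn_gt0 //; last by lra.
  have := bernoulli k; move: kd; rewrite ltr_pdivrMr // => kd bk; nra.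
elim: k => [|k [n [w [[n0 wn w1 Nw] wk]]]].
  exists 2%N, (- 1); split; last first.
    have -> : -1 - 1 = - (2%:R) :> C by rewrite opprD.
    by rewrite normc_opp normc_nat divr1.
  split=> //; first by rewrite sqrrN expr1n.
    by rewrite eq_sym -subr_eq0 opprK -(natrD _ 1 1) pnatr_eq0.
  by rewrite normc_opp normc1.
have [v [vw Rv]] : exists v : C, v ^+ 2 = w /\ 0 <= complex.Re v.
  have := sqr_sqrtc w; set v := sqrtc w => vw.
  have [vp|vn] := leP 0 (complex.Re v); first by exists v.
  by exists (- v); rewrite sqrrN raddfN oppr_ge0 ltW.
have Nv : N v = 1.
  have := normcX v 2; rewrite vw Nw => /esym /eqP.
  by rewrite sqrp_eq1 ?normc_ge0 // => /eqP.
have v1 : 4 / 3 <= N (v + 1).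
  have : N v ^+ 2 = 1 by rewrite Nv expr1n.
  case: v Rv {vw Nv} => x y /= x0.
  rewrite sqr_sqrtr ?addr_ge0 ?sqr_ge0 // => xy.
  rewrite -[leLHS]ger0_norm ?divr_ge0 // -sqrtr_sqr ler_wsqrtr // addr0.
  by rewrite sqrrD1; lra.
exists (2 * n)%N, v; split.
  split=> //; first by rewrite muln_gt0.
    by rewrite exprM vw.
  by apply: contraNneq w1 => v1'; rewrite -vw v1' expr1n.
have wv : N (v - 1) * N (v + 1) = N (w - 1).
  by rewrite -normcM -vw -subr_sqr_1.
have q0 : (4 / 3 : R) ^+ k != 0 by rewrite expf_neq0 //; lra.
have -> : 2 / (4 / 3 : R) ^+ k.+1 = (2 / (4 / 3) ^+ k) / (4 / 3).
  by rewrite exprS; field.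
rewrite ler_pdivlMr; last by lra.
by have := normc_ge0 (v - 1); nra.
Qed.

(** For w close to 1 this stands for the mean over the circle of radius r. *)
Definition circle_mean n w (r : R) (F : C -> C) :=
  (\sum_(k < n) F (r%:C%C * w ^+ k)) / n%:R.

Lemma tri_null_sum H (m : nat) (a b c : nat -> C) :
  (forall k, tri_null H (a k) (b k) (c k)) ->
  forall e : R, 0 < e -> exists n0, forall n, (n0 <= n)%N ->
    N (\sum_(k < m) tri H n (a k) (b k) (c k)) <= e.
Proof.
move=> nul; elim: m => [|m IH] e e0.
  by exists 0%N => n _; rewrite big_ord0 normc0 ltW.
have e20 : 0 < e / 2 by lra.
have [n1 P1] := IH _ e20; have [n2 P2] := nul m _ e20.
exists (n1 + n2)%N => n nn; rewrite big_ord_recr /=.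
have := P1 n ltac:(lia); have := P2 n ltac:(lia).
set x := \sum_(_ < _) _; set y := tri _ _ _ _ _.
by have := normcD_le x y; lra.
Qed.

End CircleCauchy.

(** * Complex derivatives as directional derivatives *)

Section DeriveBridge.
Context {R : realType}.
Local Notation C := R[i].
Local Notation N := (@normc R).
Local Open Scope classical_set_scope.

Lemma gt0_complex (e : C) : 0 < e -> exists2 r : R, 0 < r & e = r%:C%C.
Proof.
case: e => x y; rewrite ltcE /= => /andP[/eqP -> x0].
by exists x.
Qed.

Lemma cdiff_is_derive (V : normedModType C) (f : V -> C) (z v : V) (a : C) :
  cdiff (fun h => f (h *: v + z)) 0 a <-> is_derive z v f a.
Proof.
pose F h := h^-1 *: ((f \o shift z) (h *: v) - f z).
have FP : cdiff (fun h => f (h *: v + z)) 0 a <-> F h @[h --> 0^'] --> a.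
  split=> [da|/cvgrPdist_le Fa].
    apply/cvgrPdist_le => e0 /gt0_complex[e {}e0 ->]; have [d d0 dP] := da _ e0.
    apply/nbhs_ballP; exists d%:C%C => /=; first by rewrite ltcR.
    move=> h; rewrite /ball /= sub0r normrN normr_normc ltcR => hd h0.
    have := dP _ hd; rewrite add0r scale0r add0r => hP.
    rewrite normr_normc lecR normc_distC.
    have -> : F h - a = (f (h *: v + z) - f z - a * h) / h.
      by rewrite /F /= /GRing.scale /=; field.
    by rewrite normcM normcV ler_pdivrMr // normc_gt0.
  move=> e e0; have /nbhs_ballP[d0 /gt0_complex[d {}d0 ->] dP] := Fa e%:C%C
    ltac:(by rewrite ltcR).
  exists d => // h hd; rewrite add0r scale0r add0r.
  have [->|h0] := eqVneq h 0.
    by rewrite scale0r add0r subrr mulr0 subr0 normc0 mulr0.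
  have := dP h; rewrite /ball /= sub0r normrN normr_normc ltcR => /(_ hd h0).
  rewrite normr_normc lecR normc_distC.
  have -> : F h - a = (f (h *: v + z) - f z - a * h) / h.
    by rewrite /F /= /GRing.scale /=; field.
  by rewrite normcM normcV ler_pdivrMr // normc_gt0.
split=> [/FP Fa|[df dE]].
  split; first by apply/cvg_ex; exists a.
  exact: (cvg_lim (@norm_hausdorff _ _) Fa).
by apply/FP; rewrite -dE; exact: df.
Qed.

Lemma cdiff_derive1 (f : C -> C) z a : cdiff f z a <-> is_derive z 1 f a.
Proof.
rewrite -cdiff_is_derive; split=> df e /df[d d0 dP]; exists d => // h /dP;
  by rewrite add0r scale0r add0r /GRing.scale /= mulr1 [h + z]addrC.
Qed.

Lemma cdiffM (f g : C -> C) z a b : cdiff f z a -> cdiff g z b ->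
  cdiff (fun w => f w * g w) z (f z * b + g z * a).
Proof.
move=> /cdiff_derive1 df /cdiff_derive1 dg; apply/cdiff_derive1.
Qed.

Lemma cdiff_quotient (f : C -> C) c p z : z != p -> (exists a, cdiff f z a) ->
  exists a, cdiff (fun w => (f w - c) / (w - p)) z a.
Proof.
move=> zp [a /cdiff_derive1 df].
have dp : derivable (fun w : C => w - p) z 1.
  by apply: derivableB; [exact: derivable_id|exact: derivable_cst].
have dv : derivable (fun w : C => (w - p)^-1) z 1.
  by apply: derivableV => //; rewrite subr_eq0.
have dq : derivable (fun w => (f w - c) / (w - p)) z 1.
  have dfc : derivable (fun w => f w - c) z 1.
    by apply: derivableB; [case: df|exact: derivable_cst].
  exact: (derivableM dfc dv).
exists ('D_1 (fun w => (f w - c) / (w - p)) z); apply/cdiff_derive1.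
exact: DeriveDef.
Qed.

End DeriveBridge.

(** * Cauchy's theorem for means over roots of unity *)

Section CauchyOnCircle.
Context {R : realType}.
Local Notation C := R[i].
Local Notation N := (@normc R).
Implicit Types (f H : C -> C) (a b c p t w z : C).

Lemma quotient_bounded f (p a : C) (M : R) (D : set C) : cdiff f p a ->
  (forall z, D z -> N (f z) <= M) -> D p ->
  exists K, forall z, D z -> N ((f z - f p) / (z - p)) <= K.
Proof.
move=> fp fM Dp; have [d d0 dP] := fp 1 ltr01.
have M0 : 0 <= M by apply: le_trans (fM _ Dp); exact: normc_ge0.
exists (1 + N a + 2 * M / d) => z Dz.
have Md : 0 <= 2 * M / d by rewrite divr_ge0 ?mulr_ge0 // ltW.
have := normc_ge0 a.
have [->|zp] := eqVneq z p; first by rewrite subrr mul0r normc0; lra.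
have zp0 : 0 < N (z - p) by rewrite normc_gt0 subr_eq0.
rewrite normcM normcV ler_pdivrMr // => a0.
have [zd|zd] := ltP (N (z - p)) d.
  have := dP _ zd; rewrite [p + _]addrC subrK mul1r => fd.
  have := normcD_le (f z - f p - a * (z - p)) (a * (z - p)).
  rewrite subrK normcM; have := mulr_ge0 Md (ltW zp0); lra.
have := normcB_le (f z) (f p); have := fM _ Dz; have := fM _ Dp.
have : 2 * M <= 2 * M / d * N (z - p).
  by rewrite mulrAC ler_pdivlMr // ler_wpM2l // mulr_ge0.
have := mulr_ge0 a0 (ltW zp0); lra.
Qed.

(** The half-plane of directions close to b - p, in which Re (k z) is the
    scalar product of b - p and z. *)
Lemma halfplane_near (b c p : C) : N (c - b) < N (b - p) ->
  exists k s, [/\ 0 < s, s <= complex.Re (k * (b - p))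
    & s <= complex.Re (k * (c - p))].
Proof.
move=> cb; have bp0 : 0 < N (b - p) by apply: le_lt_trans cb; exact: normc_ge0.
have Re_conj z : complex.Re (z^* * z)%C = N z ^+ 2.
  case: z => x y /=; rewrite sqr_sqrtr ?addr_ge0 ?sqr_ge0 //; ring.
have N_conj z : N z^*%C = N z by case: z => x y /=; rewrite sqrrN.
exists (b - p)^*%C, (N (b - p) * (N (b - p) - N (c - b))); split.
- by rewrite mulr_gt0 // subr_gt0.
- rewrite Re_conj; have := normc_ge0 (c - b); nra.
- have -> : c - p = (b - p) + (c - b) by ring.
  rewrite [X in _ <= complex.Re X]mulrDr ReD Re_conj.
  have := Re_le_normc ((b - p)^*%C * (c - b)).
  rewrite normcM N_conj ler_norml => /andP[]; nra.
Qed.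

(** With H z = (f z - f p) / (z - p) and t_k = r w^k, the sum of
    H(t_k) (t_(k+1) - t_k) = (w - 1) H(t_k) t_k is close to the trapezoid sums
    over the polygon t_0 ... t_n, by uniform continuity of H on the circle.
    Those sums are the sums over the triangles (p, t_k, t_(k+1)) and vanish in
    the limit. The common factor w - 1 cancels from both sides of the
    estimate, so no asymptotics of n (w - 1) is needed. *)
Lemma circle_cauchy f (M r0 r : R) p : 0 < r -> r < r0 -> N p < r ->
  (forall z, N z < r0 -> exists u, cdiff f z u) ->
  (forall z, N z < r0 -> N (f z) <= M) ->
  forall e : R, 0 < e -> exists2 d : R, 0 < d & forall n w,
    unity_root n w -> N (w - 1) < d ->
    N (circle_mean n w r (fun t => (f t - f p) / (t - p) * t)) <= e.
Proof.
move=> r_gt0 rr0 pr fd fM e e0.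
pose H z := (f z - f p) / (z - p).
have sub_r z : cdisc r z -> N z < r0 by move/le_lt_trans; apply.
have cp : cdisc r p by exact: ltW.
have [u fu] : exists u, cdiff f p u by apply: fd; exact: lt_trans rr0.
have [K HK] := quotient_bounded fu (fun z rz => fM z (sub_r z rz)) cp.
have Hd z : cdisc r z -> z != p -> exists u, cdiff H z u.
  by move=> /sub_r /fd fz zp; exact: cdiff_quotient.
have Hc t : N t = r -> ccont H t.
  move=> tr; have [||v /cdiff_ccont//] := Hd t; first by rewrite /cdisc /= tr.
  by apply/eqP => tp; rewrite -tp tr ltxx in pr.
have er0 : 0 < e / r by rewrite divr_gt0.
have [d1 d10 d1P] := circle_unif_cont Hc er0.
exists (Num.min (d1 / r) ((r - N p) / r)).
  by rewrite lt_min !divr_gt0 // subr_gt0.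
move=> n w [n0 wn w1 Nw]; rewrite lt_min => /andP[].
rewrite !ltr_pdivlMr // ![_ * r]mulrC => wd1 wp.
pose t k : C := r%:C%C * w ^+ k.
have tr k : N (t k) = r.
  by rewrite normcM normc_real gtr0_norm // normcX Nw expr1n mulr1.
have dt k : t k.+1 - t k = (w - 1) * t k by rewrite /t exprS; ring.
have Ndt k : N (t k.+1 - t k) = r * N (w - 1) by rewrite dt normcM tr mulrC.
have tn : t n = t 0%N by rewrite /t wn.
have step m k : N (trap H m (t k) (t k.+1) - H (t k) * (t k.+1 - t k))
    <= e / r * (r * N (w - 1)).
  pose D : set C := [set z | N (z - t k) <= r * N (w - 1)]%classic.
  have Dtk : D (t k) by rewrite /D /= subrr normc0 -(Ndt k) normc_ge0.
  have Dtk1 : D (t k.+1) by rewrite /D /= Ndt.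
  have := trap_near_affine (H := H) (u := H (t k)) (v := 0) m
    (@ball_midclosed _ (t k) (r * N (w - 1))).
  move=> /(_ (e / r) (t k) (t k.+1) _ Dtk Dtk1); rewrite !mul0r addr0 Ndt.
  apply => z zD; rewrite mul0r addr0; apply: d1P; first exact: tr.
  exact: le_lt_trans wd1.
(* The edges from p cancel because the polygon closes up. *)
have tri_sum m : \sum_(k < n) trap H m (t k) (t k.+1) =
    \sum_(k < n) tri H m p (t k) (t k.+1).
  have -> : \sum_(k < n) tri H m p (t k) (t k.+1) =
     \sum_(k < n) trap H m (t k) (t k.+1)
       - \sum_(k < n) (trap H m p (t k.+1) - trap H m p (t k)).
    rewrite -sumrB; apply: eq_bigr => k _.
    by rewrite /tri (trapC H m p (t k.+1)); ring.
  rewrite -(big_mkord xpredT (fun k => trap H m p (t k.+1) - trap H m p (t k))).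
  by rewrite telescope_sumr // tn subrr subr0.
have nul k : tri_null H p (t k) (t k.+1).
  have [|h [s [s0 sb sc]]] := @halfplane_near (t k) (t k.+1) p.
    rewrite Ndt; apply: lt_le_trans wp _.
    have := normcD_le (t k - p) p; rewrite subrK tr; lra.
  by apply: (tri_null_corner HK Hd cp _ _ s0 sb sc); rewrite /cdisc /= tr.
have nR0 : 0 < n%:R :> R by rewrite ltr0n.
rewrite /circle_mean normcM normcV normc_nat ler_pdivrMr //.
rewrite -(ler_pM2l (_ : 0 < N (w - 1))) ?normc_gt0 ?subr_eq0 // -normcM.
rewrite mulr_sumr; apply/ler_addgt0Pr => e1 e10.
have [m /(_ m (leqnn m))] := @tri_null_sum _ H n (fun=> p) t (fun k => t k.+1)
  nul _ e10.
rewrite -tri_sum => sum_small.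
have diff_small : N (\sum_(k < n) (trap H m (t k) (t k.+1) - H (t k) * (t k.+1
  - t k)))
    <= n%:R * (e * N (w - 1)).
  apply: le_trans (normc_sum _ _) _.
  rewrite -[n in n%:R]card_ord -sum1_card natr_sum mulr_suml.
  apply: ler_sum => k _; rewrite mul1r; apply: le_trans (step m k) _.
  by rewrite mulrA divfK // gt_eqF.
rewrite sumrB in diff_small.
have -> : \sum_(k < n) (w - 1) * ((f (t k) - f p) / (t k - p) * t k) =
    \sum_(k < n) H (t k) * (t k.+1 - t k).
  by apply: eq_bigr => k _; rewrite dt /H; ring.
set X := \sum_(_ < _) H _ * _ in diff_small *.
set Y := \sum_(_ < _) trap _ _ _ _ in diff_small sum_small.
have := normcB_le Y (Y - X); rewrite subKr; lra.
Qed.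

End CauchyOnCircle.

(** * Taylor coefficients as limits of circle means *)

Section TaylorCoefficients.
Context {R : realType}.
Local Notation C := R[i].
Local Notation N := (@normc R).
Implicit Types (f F G : C -> C) (a b c p t w z : C).

Definition bounded_holo f (r0 M : R) :=
  (forall z, N z < r0 -> exists u, cdiff f z u) /\
  (forall z, N z < r0 -> N (f z) <= M).

Lemma unity_root_sum n w : w ^+ n = 1 -> w != 1 -> \sum_(k < n) w ^+ k = 0.
Proof.
move=> wn w1; have : (w - 1) * \sum_(k < n) w ^+ k = 0.
  by rewrite -subrX1 wn subrr.
by move/eqP; rewrite mulf_eq0 subr_eq0 (negPf w1) => /eqP.
Qed.

Lemma circle_meanD n w r F G :
  circle_mean n w r (fun t => F t + G t) = circle_mean n w r F + circle_mean n
    w r G.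
Proof. by rewrite /circle_mean big_split mulrDl. Qed.

Lemma circle_meanZ n w r F c :
  circle_mean n w r (fun t => F t * c) = circle_mean n w r F * c.
Proof. by rewrite /circle_mean -mulr_suml mulrAC. Qed.

Lemma norm_circle w n (r : R) k : 0 < r -> unity_root n w ->
  N (r%:C%C * w ^+ k) = r.
Proof.
by move=> r0 [_ _ _ Nw]; rewrite normcM normc_real gtr0_norm // normcX Nw
  expr1n mulr1.
Qed.

Lemma circle_mean_eq n w r F G : 0 < r -> unity_root n w ->
  (forall t, N t = r -> F t = G t) -> circle_mean n w r F = circle_mean n w r G.
Proof.
move=> r0 wr FG; rewrite /circle_mean; congr (_ / _); apply: eq_bigr => k _.
by apply/FG/(norm_circle k r0 wr).
Qed.

Lemma circle_mean_le n w r F (B : R) : 0 < r -> unity_root n w ->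
  (forall t, N t = r -> N (F t) <= B) -> N (circle_mean n w r F) <= B.
Proof.
move=> r0 wr FB; have [n0 _ _ _] := wr.
rewrite /circle_mean normcM normcV normc_nat ler_pdivrMr ?ltr0n //.
apply: le_trans (normc_sum _ _) _.
rewrite -[n in n%:R]card_ord -sum1_card natr_sum mulr_sumr.
by apply: ler_sum => k _; rewrite mulr1; apply/FB/(norm_circle k r0 wr).
Qed.

Lemma circle_mean_cst n w r c : (0 < n)%N -> circle_mean n w r (fun=> c) = c.
Proof.
move=> n0; rewrite /circle_mean sumr_const card_ord -[c *+ n]mulr_natr mulfK //.
by rewrite pnatr_eq0 -lt0n.
Qed.

Lemma circle_mean_invX n w r j : unity_root n w -> w ^+ j != 1 ->
  circle_mean n w r (fun t => (t ^+ j)^-1) = 0.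
Proof.
move=> [n0 wn _ _] wj; rewrite /circle_mean.
have -> : \sum_(k < n) ((r%:C%C * w ^+ k) ^+ j)^-1 =
    \sum_(k < n) (r%:C%C ^+ j)^-1 * (w ^+ j)^-1 ^+ k.
  apply: eq_bigr => k _; rewrite exprMn invfM; congr (_ * _).
  by rewrite exprVn -!exprM mulnC.
rewrite -mulr_sumr unity_root_sum ?mulr0 ?mul0r //.
  by rewrite exprVn -exprM mulnC exprM wn expr1n invr1.
by rewrite invr_eq1.
Qed.

Lemma unity_root_sqr_neq1 n w : unity_root n w -> N (w - 1) < 1 -> w ^+ 2 != 1.
Proof.
move=> [_ _ w1 _] wlt; rewrite sqrf_eq1 negb_or w1 /=; apply/eqP => wN1.
move: wlt; rewrite wN1 -opprD normc_opp -(natrD _ 1 1) normc_nat; lra.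
Qed.

Definition coeff n w r f j := circle_mean n w r (fun t => f t / t ^+ j).

Lemma coeff_le f (r0 M r : R) n w j : 0 < r -> r < r0 -> bounded_holo f r0 M ->
  unity_root n w -> N (coeff n w r f j) <= M / r ^+ j.
Proof.
move=> r_gt0 rr0 [_ fM] wr; apply: circle_mean_le => // t tr.
by rewrite normcM normcV normcX tr ler_pM2r ?invr_gt0 ?exprn_gt0 // fM // tr.
Qed.

(** From t / (t - p) = 1 + p/t + (p/t)^2 + p^3 / (t^2 (t - p)); the powers
    1/t and 1/t^2 have mean 0, as soon as w and w^2 differ from 1. *)
Lemma taylor_mean f (M r0 r : R) p : 0 < r -> r < r0 -> N p <= r / 2 ->
  bounded_holo f r0 M ->
  forall e : R, 0 < e -> exists2 d : R, 0 < d & forall n w,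
    unity_root n w -> N (w - 1) < d ->
    N (f p - coeff n w r f 0 - coeff n w r f 1 * p - coeff n w r f 2 * p ^+ 2)
      <= e + 4 * M / r ^+ 3 * N p ^+ 3.
Proof.
move=> r_gt0 rr0 pr2 fh e e0; have [fd fM] := fh.
have pr : N p < r by lra.
have [d d0 dP] := circle_cauchy r_gt0 rr0 pr fd fM e0.
exists (Num.min d 1); first by rewrite lt_min d0 ltr01.
move=> n w wr; rewrite lt_min => /andP[wd wlt1].
have w2 := unity_root_sqr_neq1 wr wlt1.
have [n0 _ w1 _] := wr.
pose rem t := (f t - f p) * p ^+ 3 / (t ^+ 2 * (t - p)).
have mean_eq : circle_mean n w r (fun t => (f t - f p) / (t - p) * t) =
   coeff n w r f 0 + coeff n w r f 1 * p + coeff n w r f 2 * p ^+ 2 - f p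
   + circle_mean n w r rem.
  have -> : circle_mean n w r (fun t => (f t - f p) / (t - p) * t) =
     circle_mean n w r (fun t => f t / t ^+ 0 + f t / t ^+ 1 * p
       + f t / t ^+ 2 * p ^+ 2 + (- f p) + (t ^+ 1)^-1 * (- f p * p)
       + (t ^+ 2)^-1 * (- f p * p ^+ 2) + rem t).
    apply: circle_mean_eq => // t tr.
    have t0 : t != 0 by rewrite -normc_eq0 tr gt_eqF.
    have tp : t - p != 0 by rewrite subr_eq0; apply/eqP => tp; rewrite -tp tr
      ltxx in pr.
    by rewrite /rem expr0 expr1; field; rewrite t0 tp.
  by rewrite !circle_meanD -!/(coeff n w r f _) !circle_meanZ circle_mean_cst
    // !circle_mean_invX //
    !mul0r !addr0.
have rem_le : N (circle_mean n w r rem) <= 4 * M / r ^+ 3 * N p ^+ 3.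
  apply: circle_mean_le => // t tr; rewrite /rem !normcM normcV normcM !normcX tr.
  have M0 : 0 <= M by apply: le_trans (fM 0 _); rewrite ?normc0 ?normc_ge0//; lra.
  have fbd : N (f t - f p) <= 2 * M.
    have ft := fM t ltac:(lra); have fp := fM p ltac:(lra).
    by have := normcB_le (f t) (f p); lra.
  have tp : r / 2 <= N (t - p) by have := normcD_le (t - p) p; rewrite subrK
    tr; lra.
  have tp0 : 0 < N (t - p) by lra.
  have p3 : 0 <= N p ^+ 3 by rewrite exprn_ge0 // normc_ge0.
  rewrite ler_pdivrMr ?mulr_gt0 ?exprn_gt0 //.
  have -> : 4 * M / r ^+ 3 * N p ^+ 3 * (r ^+ 2 * N (t - p)) =
    4 * M * N p ^+ 3 * N (t - p) / r by field; exact: lt0r_neq0.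
  rewrite ler_pdivlMr //.
  apply: le_trans (_ : 2 * M * N p ^+ 3 * r <= _).
    by rewrite ler_pM2r // ler_wpM2r.
  have := mulr_ge0 M0 p3; nra.
have := dP n w wr wd; rewrite mean_eq.
set X := coeff _ _ _ _ 0; set Y := coeff _ _ _ _ 1 * p; set Z := coeff _ _ _ _
  2 * _.
set W := circle_mean _ _ _ _ in rem_le *.
have -> : f p - X - Y - Z = W - (X + Y + Z - f p + W) by ring.
have := normcB_le W (X + Y + Z - f p + W); lra.
Qed.

Lemma coeff0_cvg f (M r0 r : R) : 0 < r -> r < r0 -> bounded_holo f r0 M ->
  forall e : R, 0 < e -> exists2 d : R, 0 < d & forall n w,
    unity_root n w -> N (w - 1) < d -> N (coeff n w r f 0 - f 0) <= e.
Proof.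
move=> r_gt0 rr0 fh e e0.
have N0r : N (0 : C) <= r / 2 by rewrite normc0; lra.
have [d d0 dP] := taylor_mean r_gt0 rr0 N0r fh e0.
exists d => // n w wr wd; have := dP n w wr wd.
by rewrite normc0 !expr0n /= !mulr0 !subr0 addr0 normc_distC.
Qed.

(** The expansion at one small real point p compares the first coefficient
    with the difference quotient of f at p, up to O(|p|). *)
Lemma coeff1_cvg f (M r0 r : R) a : 0 < r -> r < r0 -> bounded_holo f r0 M ->
  cdiff f 0 a -> forall e : R, 0 < e -> exists2 d : R, 0 < d & forall n w,
    unity_root n w -> N (w - 1) < d -> N (coeff n w r f 1 - a) <= e.
Proof.
move=> r_gt0 rr0 fh fa e e0; have [_ fM] := fh.
have M0 : 0 <= M by apply: le_trans (fM 0 _); rewrite ?normc0 ?normc_ge0//; lra.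
have e4 : 0 < e / 4 by lra.
have [d1 d10 d1P] := fa _ e4.
pose K := 3 * M / r ^+ 2.
have K0 : 0 <= K by rewrite /K divr_ge0 ?mulr_ge0 ?exprn_ge0 // ltW.
have [s [s0 sr sd sK]] : exists s : R, [/\ 0 < s, s <= r / 2, s < d1 & K * s <=
  e / 4].
  exists (Num.min (r / 2) (Num.min (d1 / 2) (e / 4 / (K + 1)))).
  have K1 : 0 < K + 1 by lra.
  have sK0 : 0 < e / 4 / (K + 1) by rewrite divr_gt0.
  split.
  - by rewrite !lt_min sK0; apply/and3P; split; lra.
  - by rewrite ge_min lexx.
  - by rewrite !gt_min; apply/orP; right; apply/orP; left; lra.
  - set s := Num.min _ _.
    have s1 : s * (K + 1) <= e / 4.
      by rewrite -ler_pdivlMr // /s !ge_min lexx !orbT.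
    have : 0 < s by rewrite !lt_min sK0; apply/and3P; split; lra.
    lra.
pose p : C := s%:C%C.
have Np : N p = s by rewrite normc_real gtr0_norm.
have pr : N p <= r / 2 by rewrite Np.
have es0 : 0 < e * s / 4 by rewrite divr_gt0 ?mulr_gt0.
have [d2 d20 d2P] := taylor_mean r_gt0 rr0 pr fh es0.
have [d3 d30 d3P] := coeff0_cvg r_gt0 rr0 fh es0.
exists (Num.min d2 d3); first by rewrite lt_min d20.
move=> n w wr; rewrite lt_min => /andP[wd2 wd3].
have := d2P n w wr wd2; have := d3P n w wr wd3.
have := coeff_le 2 r_gt0 rr0 fh wr.
set m0 := coeff _ _ _ _ 0; set m1 := coeff _ _ _ _ 1; set m2 := coeff _ _ _ _ 2.
move=> m2M m0e me.
have := d1P p; rewrite Np add0r => /(_ sd) ape.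
rewrite -(ler_pM2r s0) -{1}Np -normcM.
have -> : (m1 - a) * p = (f p - f 0 - a * p) + (f 0 - m0) - m2 * p ^+ 2
    - (f p - m0 - m1 * p - m2 * p ^+ 2) by ring.
have m2p : N (m2 * p ^+ 2) <= M / r ^+ 2 * s ^+ 2.
  by rewrite normcM normcX Np ler_wpM2r // exprn_ge0 // ltW.
have m3 : 4 * M / r ^+ 3 * s ^+ 3 <= 2 * M / r ^+ 2 * s ^+ 2.
  have -> : 4 * M / r ^+ 3 * s ^+ 3 = (4 * M / r ^+ 2 * s ^+ 2) * s / r.
    by field; exact: lt0r_neq0.
  rewrite ler_pdivrMr //.
  have X0 : 0 <= M / r ^+ 2 * s ^+ 2.
    by rewrite mulr_ge0 ?divr_ge0 ?exprn_ge0 // ltW.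
  have -> : 4 * M / r ^+ 2 * s ^+ 2 * s = 4 * (M / r ^+ 2 * s ^+ 2) * s by ring.
  have -> : 2 * M / r ^+ 2 * s ^+ 2 * r = 2 * (M / r ^+ 2 * s ^+ 2) * r by ring.
  nra.
have Ks : M / r ^+ 2 * s ^+ 2 + 2 * M / r ^+ 2 * s ^+ 2 = K * s * s.
  by rewrite /K; ring.
have Kss : K * s * s <= e / 4 * s by rewrite ler_pM2r.
move: me; rewrite Np; move: m0e; rewrite [N (m0 - _)]normc_distC.
set A := f p - f 0 - a * p in ape *; set B := f 0 - m0.
set D := m2 * p ^+ 2 in m2p *; set E := f p - _ - _ - D.
move=> Be Ee.
have := normcB_le (A + B - D) E; have := normcB_le (A + B) D.
have := normcD_le A B. lra.
Qed.

End TaylorCoefficients.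

(** * Second-order expansions and mixed derivatives *)

Section TaylorExpansion.
Context {R : realType}.
Local Notation C := R[i].
Local Notation N := (@normc R).
Implicit Types (f F G : C -> C) (a b c p t w z : C).

(** Along r / 2^k the values of q converge geometrically. *)
Lemma cvg_at0 (q : C -> C) (r K : R) : 0 < r -> 0 <= K ->
  (forall p p', 0 < N p <= r -> 0 < N p' <= r -> N (q p - q p') <= K * (N p + N
    p')) ->
  exists a, forall p, 0 < N p <= r -> N (q p - a) <= K * N p.
Proof.
move=> r0 K0 qK.
pose s k : C := (r / 2 ^+ k)%:C%C.
have Ns k : N (s k) = r / 2 ^+ k.
  by rewrite normc_real ger0_norm // divr_ge0 ?exprn_ge0 // ltW.
have p2 k : 1 <= (2 : R) ^+ k by apply: exprn_ege1; rewrite ler1n.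
have s_r k : 0 < N (s k) <= r.
  rewrite Ns divr_gt0 ?exprn_gt0 //= ler_pdivrMr ?exprn_gt0 //.
  by rewrite ler_peMr // ltW.
have [k|a aP] := @geometric_cvg R (2 * K * r) (fun k => q (s k)).
  apply: le_trans (qK _ _ (s_r _) (s_r _)) _; rewrite !Ns exprS.
  have := p2 k => pk.
  have -> : K * (r / (2 * 2 ^+ k) + r / 2 ^+ k) = 3 / 2 * (K * r) / 2 ^+ k.
    by field; lra.
  rewrite ler_pM2r ?invr_gt0; last by lra.
  by have := mulr_ge0 K0 (ltW r0); lra.
exists a => p pr; apply/ler_addgt0Pr => e e0.
have [k kP] := half_pow_small (9 * K * r) e0.
have := qK _ _ pr (s_r k); have := aP k; rewrite Ns.
have := normc_triangle (q (s k)) (q p) a.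
have E9 : 9 * K * r / 2 ^+ k = 9 * (K * (r / 2 ^+ k)) by rewrite -!mulrA.
rewrite {}E9 in kP.
have -> : 4 * (2 * K * r) / 2 ^+ k = 8 * (K * (r / 2 ^+ k)).
  by field; have := p2 k; lra.
lra.
Qed.

Lemma cdiff_quad f z a (r K : R) : 0 < r ->
  (forall h, N h <= r -> N (f (z + h) - f z - a * h) <= K * N h ^+ 2) ->
  cdiff f z a.
Proof.
move=> r0 fK e e0.
pose L := `|K| + 1; have L0 : 0 < L by rewrite /L; have := normr_ge0 K; lra.
exists (Num.min r (e / L)); first by rewrite lt_min r0 divr_gt0.
move=> h; rewrite lt_min => /andP[hr he]; apply: le_trans (fK _ (ltW hr)) _.
rewrite expr2 mulrA ler_wpM2r ?normc_ge0 //.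
move: he; rewrite ltr_pdivlMr // mulrC => /ltW; apply: le_trans.
by rewrite ler_wpM2r ?normc_ge0 // /L; have := ler_norm K; lra.
Qed.

Lemma bounded_holo_ge0 f (r0 M : R) : 0 < r0 -> bounded_holo f r0 M -> 0 <= M.
Proof.
by move=> r00 [_ fM]; apply: le_trans (fM 0 _); rewrite ?normc0 ?normc_ge0.
Qed.

Lemma cauchy_estimate f (r0 M r : R) a : 0 < r -> r < r0 ->
  bounded_holo f r0 M -> cdiff f 0 a -> N a <= M / r.
Proof.
move=> r_gt0 rr0 fh fa; apply/ler_addgt0Pr => e e0.
have [d d0 dP] := coeff1_cvg r_gt0 rr0 fh fa e0.
have [n [w [wr wd]]] := unity_root_near1 d0.
have := dP n w wr wd; have := coeff_le 1 r_gt0 rr0 fh wr.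
set m := coeff _ _ _ _ _; have := normcB_le m (m - a); rewrite subKr expr1; lra.
Qed.

(** The quotient q p = (f p - f 0 - a p) / p^2 differs from the second mean
    coefficient by O(|p|). That coefficient does not depend on p, so q has a
    limit at 0, and the coefficient tends to the same limit. *)
Lemma taylor_order2 f (r0 M r : R) a : 0 < r -> r < r0 ->
  bounded_holo f r0 M -> cdiff f 0 a ->
  exists a2,
   (forall p, N p <= r / 2 ->
     N (f p - f 0 - a * p - a2 * p ^+ 2) <= 4 * M / r ^+ 3 * N p ^+ 3) /\
   (forall e : R, 0 < e -> exists2 d : R, 0 < d & forall n w,
      unity_root n w -> N (w - 1) < d -> N (coeff n w r f 2 - a2) <= e).
Proof.
move=> r_gt0 rr0 fh fa.
have M0 : 0 <= M by apply: bounded_holo_ge0 fh; lra.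
pose K := 4 * M / r ^+ 3.
have K0 : 0 <= K by rewrite /K divr_ge0 ?mulr_ge0 ?exprn_ge0 // ltW.
pose q p := (f p - f 0 - a * p) / p ^+ 2.
have q_coeff p : 0 < N p -> N p <= r / 2 -> forall e : R, 0 < e ->
    exists2 d : R, 0 < d & forall n w, unity_root n w -> N (w - 1) < d ->
      N (q p - coeff n w r f 2) <= e + K * N p.
  move=> p0 pr e e0; set x := N p in p0 pr *.
  have e1 : 0 < e * x ^+ 2 / 3 by rewrite divr_gt0 ?mulr_gt0 ?exprn_gt0.
  have e2 : 0 < e * x / 3 by rewrite divr_gt0 ?mulr_gt0.
  have [d1 d10 d1P] := taylor_mean r_gt0 rr0 pr fh e1.
  have [d2 d20 d2P] := coeff0_cvg r_gt0 rr0 fh e1.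
  have [d3 d30 d3P] := coeff1_cvg r_gt0 rr0 fh fa e2.
  exists (Num.min d1 (Num.min d2 d3)); first by rewrite !lt_min d10 d20.
  move=> n w wr; rewrite !lt_min => /and3P[wd1 wd2 wd3].
  have := d1P n w wr wd1; have := d2P n w wr wd2; have := d3P n w wr wd3.
  set m0 := coeff _ _ _ _ 0; set m1 := coeff _ _ _ _ 1; set m2 := coeff _ _ _ _ 2.
  rewrite -/K -/x => m1e m0e me.
  have -> : q p - m2 = (f p - m0 - m1 * p - m2 * p ^+ 2 + (m0 - f 0) + (m1 - a) * p)
     / p ^+ 2 by rewrite /q; field; rewrite -normc_eq0 gt_eqF.
  rewrite normcM normcV normcX ler_pdivrMr ?exprn_gt0 // -/x.
  have m1p : N ((m1 - a) * p) <= e * x / 3 * x by rewrite normcM ler_pM2r.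
  have -> : (e + K * x) * x ^+ 2 = e * x ^+ 2 / 3 + K * x ^+ 3
     + e * x ^+ 2 / 3 + e * x / 3 * x by field.
  set A := _ - m2 * _ in me *; set B := m0 - f 0 in m0e *.
  have := normcD_le (A + B) ((m1 - a) * p); have := normcD_le A B; lra.
have r2 : 0 < r / 2 by lra.
have [|a2 a2P] := @cvg_at0 q (r / 2) K r2 K0.
  move=> p p' /andP[p0 pr] /andP[p0' pr']; apply/ler_addgt0Pr => e e0.
  have e20 : 0 < e / 2 by lra.
  have [d1 d10 d1P] := q_coeff _ p0 pr _ e20.
  have [d2 d20 d2P] := q_coeff _ p0' pr' _ e20.
  have d120 : 0 < Num.min d1 d2 by rewrite lt_min d10.
  have [n [w [wr]]] := unity_root_near1 d120; rewrite lt_min => /andP[wd1 wd2].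
  have := d1P n w wr wd1; have := d2P n w wr wd2; rewrite [N (q p' - _)]normc_distC.
  by have := normc_triangle (coeff n w r f 2) (q p) (q p'); lra.
exists a2; split=> [p pr|e e0].
  have [->|p0] := eqVneq p 0.
    by rewrite expr2 !mulr0 subrr !subr0 normc0 [0 ^+ 3]exprS mul0r mulr0.
  have Np0 : 0 < N p by rewrite normc_gt0.
  have := a2P p; rewrite Np0 pr => /(_ isT).
  have -> : f p - f 0 - a * p - a2 * p ^+ 2 = (q p - a2) * p ^+ 2.
    by rewrite /q; field.
  rewrite normcM normcX => qa.
  have -> : 4 * M / r ^+ 3 * N p ^+ 3 = K * N p * N p ^+ 2 by rewrite /K; ring.
  by rewrite ler_wpM2r // exprn_ge0 // normc_ge0.
have K1 : 0 < K + 1 by lra.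
have s0 : 0 < e / 3 / (K + 1) by rewrite !divr_gt0.
pose s := Num.min (r / 2) (e / 3 / (K + 1)).
have s00 : 0 < s by rewrite lt_min r2.
have sr : s <= r / 2 by rewrite ge_min lexx.
have sK : K * s <= e / 3.
  have : s * (K + 1) <= e / 3 by rewrite -ler_pdivlMr // ge_min lexx orbT.
  lra.
have Ns : N s%:C%C = s by rewrite normc_real gtr0_norm.
have e3 : 0 < e / 3 by lra.
have Ns0 : 0 < N s%:C%C by rewrite Ns.
have Nsr : N s%:C%C <= r / 2 by rewrite Ns.
have [d d0 dP] := q_coeff _ Ns0 Nsr _ e3.
exists d => // n w wr wd; have := dP n w wr wd; have := a2P s%:C%C.
rewrite Ns0 Nsr => /(_ isT); rewrite Ns.
have := normc_triangle (q s%:C%C) (coeff n w r f 2) a2.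
by rewrite [N (coeff _ _ _ _ _ - q _)]normc_distC; lra.
Qed.

Lemma taylor_order1 f (r0 M r : R) a : 0 < r -> r < r0 ->
  bounded_holo f r0 M -> cdiff f 0 a ->
  forall p, N p <= r / 2 -> N (f p - f 0 - a * p) <= 3 * M / r ^+ 2 * N p ^+ 2.
Proof.
move=> r_gt0 rr0 fh fa p pr.
have M0 : 0 <= M by apply: bounded_holo_ge0 fh; lra.
have [a2 [fp a2P]] := taylor_order2 r_gt0 rr0 fh fa.
have a2M : N a2 <= M / r ^+ 2.
  apply/ler_addgt0Pr => e e0; have [d d0 dP] := a2P e e0.
  have [n [w [wr wd]]] := unity_root_near1 d0.
  have := dP n w wr wd; have := coeff_le 2 r_gt0 rr0 fh wr.
  set m := coeff _ _ _ _ _; have := normcB_le m (m - a2); rewrite subKr; lra.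
have := fp p pr; have p2 : 0 <= N p ^+ 2 by rewrite exprn_ge0 ?normc_ge0.
have a2p : N (a2 * p ^+ 2) <= M / r ^+ 2 * N p ^+ 2.
  by rewrite normcM normcX ler_wpM2r.
have : 4 * M / r ^+ 3 * N p ^+ 3 <= 2 * (M / r ^+ 2 * N p ^+ 2).
  have -> : 4 * M / r ^+ 3 * N p ^+ 3 = 4 * (M / r ^+ 2 * N p ^+ 2) * N p / r.
    by field; exact: lt0r_neq0.
  rewrite ler_pdivrMr //.
  have X0 : 0 <= M / r ^+ 2 * N p ^+ 2.
    by rewrite mulr_ge0 ?divr_ge0 ?exprn_ge0 ?normc_ge0 // ltW.
  nra.
have -> : 3 * M / r ^+ 2 * N p ^+ 2 = 3 * (M / r ^+ 2 * N p ^+ 2) by ring.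
have := normcD_le (f p - f 0 - a * p - a2 * p ^+ 2) (a2 * p ^+ 2); rewrite subrK.
lra.
Qed.

Lemma cdiff_shift f z w a :
  cdiff (fun h => f (z + h)) w a <-> cdiff f (z + w) a.
Proof.
by split=> fa e /fa[d d0 dP]; exists d => // h /dP; rewrite addrA.
Qed.

Lemma cdiff_unique f z a b : cdiff f z a -> cdiff f z b -> a = b.
Proof. by move=> /cdiff_derive1[_ <-] /cdiff_derive1[_ <-]. Qed.

(** The remainder of the second-order expansion is O(|z|^3) on the disc of
    radius |z| around z, so Cauchy's estimate bounds its derivative there by
    O(|z|^2). *)
Lemma cdiff_taylor2 f (f1 : C -> C) (r0 M r : R) : 0 < r -> r < r0 ->
  bounded_holo f r0 M -> (forall z, N z < r0 -> cdiff f z (f1 z)) ->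
  exists a2, cdiff f1 0 (2 * a2) /\
   (forall e : R, 0 < e -> exists2 d : R, 0 < d & forall n w,
      unity_root n w -> N (w - 1) < d -> N (coeff n w r f 2 - a2) <= e).
Proof.
move=> r_gt0 rr0 fh fd.
have M0 : 0 <= M by apply: bounded_holo_ge0 fh; lra.
have fa : cdiff f 0 (f1 0) by apply: fd; rewrite normc0; lra.
have [a2 [fp a2P]] := taylor_order2 r_gt0 rr0 fh fa.
exists a2; split=> //.
pose rem p := f p - f 0 - f1 0 * p - a2 * p ^+ 2.
have remd z : N z < r0 -> cdiff rem z (f1 z - f1 0 - 2 * a2 * z).
  move=> /fd fz e e0; have e20 : 0 < e / 2 by lra.
  have [d d0 dP] := fz _ e20.
  have K0 : 0 < N a2 + 1 by have := normc_ge0 a2; lra.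
  exists (Num.min d (e / 2 / (N a2 + 1))); first by rewrite lt_min d0 divr_gt0.
  move=> h; rewrite lt_min => /andP[/dP fh']; rewrite ltr_pdivlMr // => he.
  have -> : rem (z + h) - rem z - (f1 z - f1 0 - 2 * a2 * z) * h =
     (f (z + h) - f z - f1 z * h) - a2 * h * h by rewrite /rem; ring.
  have : N (a2 * h * h) <= e / 2 * N h.
    rewrite !normcM ler_wpM2r ?normc_ge0 //.
    by have := normc_ge0 h; have := normc_ge0 a2; nra.
  have := normcB_le (f (z + h) - f z - f1 z * h) (a2 * h * h); lra.
pose K := 4 * M / r ^+ 3.
have K0 : 0 <= K by rewrite /K divr_ge0 ?mulr_ge0 ?exprn_ge0 // ltW.
have r4 : 0 < r / 4 by lra.
apply: (@cdiff_quad _ _ _ _ (16 * K) r4) => z zr; rewrite add0r.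
have [->|z0] := eqVneq z 0.
  by rewrite mulr0 subrr subr0 normc0 expr0n /= mulr0.
have Nz0 : 0 < N z by rewrite normc_gt0.
have z2 : 0 < N z / 2 by lra.
have zz : N z / 2 < N z by lra.
have remh : bounded_holo (fun h => rem (z + h)) (N z) (8 * K * N z ^+ 3).
  split=> h hz; have zh := normcD_le z h.
    exists (f1 (z + h) - f1 0 - 2 * a2 * (z + h)); apply/cdiff_shift.
    by apply: remd; lra.
  have zhr : N (z + h) <= r / 2 by lra.
  apply: le_trans (fp _ zhr) _; rewrite -/K.
  have -> : 8 * K * N z ^+ 3 = K * (2 * N z) ^+ 3 by ring.
  by rewrite ler_wpM2l // lerXn2r ?nnegrE ?mulr_ge0 ?normc_ge0 //; lra.
have dz : cdiff (fun h => rem (z + h)) 0 (f1 z - f1 0 - 2 * a2 * z).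
  by apply/cdiff_shift; rewrite addr0; apply: remd; lra.
have := cauchy_estimate z2 zz remh dz.
by have -> : 8 * K * N z ^+ 3 / (N z / 2) = 16 * K * N z ^+ 2 by field; exact:
  lt0r_neq0.
Qed.

(** The quotients q t s = (G s t - G s 0) / t are holomorphic in s and
    converge to Dt s, uniformly in s, as t tends to 0. By Cauchy's estimate
    their derivatives d t = (Ds t - Ds 0) / t at s = 0 converge as well, which
    differentiates Ds at 0, and their first-order expansions in s pass to the
    limit, which differentiates Dt at 0 with the same derivative. *)
Lemma cdiff_mixed (G : C -> C -> C) (r0 M : R) (Ds Dt : C -> C) : 0 < r0 ->
  (forall s, N s < r0 -> bounded_holo (G s) r0 M) ->
  (forall t, N t < r0 -> bounded_holo (G^~ t) r0 M) ->
  (forall s, N s < r0 -> cdiff (G s) 0 (Dt s)) ->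
  (forall t, N t < r0 -> cdiff (G^~ t) 0 (Ds t)) ->
  exists a, cdiff Dt 0 a /\ cdiff Ds 0 a.
Proof.
move=> r00 Gs Gt GDt GDs.
have N0 : N (0 : C) < r0 by rewrite normc0.
have M0 : 0 <= M by exact: bounded_holo_ge0 (Gs _ N0).
pose r := r0 / 2.
have r_gt0 : 0 < r by rewrite /r; lra.
have rr0 : r < r0 by rewrite /r; lra.
pose K := 3 * M / r ^+ 2.
have K0 : 0 <= K by apply: divr_ge0; [lra|exact: exprn_ge0 (ltW r_gt0)].
pose q t s := (G s t - G s 0) / t.
have qDt s t : N s < r0 -> 0 < N t <= r / 2 -> N (q t s - Dt s) <= K * N t.
  move=> sr /andP[t0 tr].
  have := taylor_order1 r_gt0 rr0 (Gs s sr) (GDt s sr) tr; rewrite -/K => Gst.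
  have -> : q t s - Dt s = (G s t - G s 0 - Dt s * t) / t.
    by rewrite /q; field; rewrite -normc_eq0 gt_eqF.
  by rewrite normcM normcV ler_pdivrMr // -mulrA.
have cdiffB f g z a b : cdiff f z a -> cdiff g z b ->
    cdiff (fun w => f w - g w) z (a - b).
  by move=> /cdiff_derive1 fa /cdiff_derive1 gb; apply/cdiff_derive1; exact:
    is_deriveB.
have cdiffZ f z a c : cdiff f z a -> cdiff (fun w => f w / c) z (a / c).
  move=> fa; have /cdiff_derive1 cc : is_derive z 1 (fun _ : C => c^-1) 0.
    exact: is_derive_cst.
  by have := cdiffM fa cc; rewrite mulr0 add0r mulrC.
pose d t := (Ds t - Ds 0) / t.
have qd t z : N t < r0 -> N z < r0 -> exists u, cdiff (q t) z u.
  move=> tr zr; have [u Gu] := (Gt t tr).1 z zr; have [v Gv] := (Gt 0 N0).1 z zr.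
  by exists ((u - v) / t); apply/cdiffZ/cdiffB.
have q0 t : N t < r0 -> cdiff (q t) 0 (d t).
  by move=> tr; apply/cdiffZ/cdiffB; exact: GDs.
have tr0 t : 0 < N t <= r / 2 -> N t < r0 by move=> /andP[_]; rewrite /r; lra.
have [|||a aP] := @cvg_at0 d (r / 2) (K / r).
- lra.
- by rewrite divr_ge0 // ltW.
- move=> t t' tr tr'.
  have -> : K / r * (N t + N t') = K * (N t + N t') / r by rewrite mulrAC.
  apply: (cauchy_estimate r_gt0 rr0 (f := fun s => q t s - q t' s)).
    split=> s sr.
      have [u qu] := qd t s (tr0 _ tr) sr; have [v qv] := qd t' s (tr0 _ tr') sr.
      by exists (u - v); exact: cdiffB.
    have := qDt s t sr tr; have := qDt s t' sr tr'; rewrite [N (q t' s -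
      _)]normc_distC.
    by have := normc_triangle (Dt s) (q t s) (q t' s); lra.
  by apply: cdiffB; apply: q0; exact: tr0.
exists a; split; last first.
  apply: (@cdiff_quad _ _ _ (r / 2) (K / r)) => [|t tr]; first by lra.
  rewrite add0r; have [->|t0] := eqVneq t 0.
    by rewrite mulr0 subrr subr0 normc0 expr0n /= mulr0.
  have Nt0 : 0 < N t by rewrite normc_gt0.
  have := aP t; rewrite Nt0 tr => /(_ isT) da.
  have -> : Ds t - Ds 0 - a * t = (d t - a) * t by rewrite /d; field.
  by rewrite normcM expr2 mulrA ler_wpM2r // ltW.
pose L := M / r + 2 * K * r.
have Dt_le s : N s < r0 -> N (Dt s) <= M / r.
  by move=> sr; exact: cauchy_estimate r_gt0 rr0 (Gs s sr) (GDt s sr).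
apply: (@cdiff_quad _ _ _ (r / 2) (3 * L / r ^+ 2)) => [|s sr]; first by lra.
rewrite add0r; apply/ler_addgt0Pr => e e0.
have sr0 : N s < r0 by rewrite /r in sr; lra.
have Kr0 : 0 <= K / r by rewrite divr_ge0 // ltW.
have B0 : 0 < 2 * K + K / r * N s + 1.
  by have := mulr_ge0 Kr0 (normc_ge0 s); lra.
pose x := Num.min (r / 2) (e / (2 * K + K / r * N s + 1)).
have x0 : 0 < x by rewrite lt_min; apply/andP; split; [lra|rewrite divr_gt0].
have xr : x <= r / 2 by rewrite ge_min lexx.
have xe : x * (2 * K + K / r * N s + 1) <= e.
  by rewrite -ler_pdivlMr // ge_min lexx orbT.
have Nx : N x%:C%C = x by rewrite normc_real gtr0_norm.
set t : C := x%:C%C in Nx.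
have tr : 0 < N t <= r / 2 by rewrite Nx x0.
have qh : bounded_holo (q t) r0 L.
  split=> z zr; first exact: qd (tr0 _ tr) zr.
  have := qDt z t zr tr; have := Dt_le z zr; have := normcD_le (q t z - Dt z)
    (Dt z).
  rewrite subrK Nx /L => ? ? ?.
  have : K * x <= K * r by rewrite ler_wpM2l //; lra.
  have := mulr_ge0 K0 (ltW r_gt0); lra.
have := taylor_order1 r_gt0 rr0 qh (q0 t (tr0 _ tr)) sr.
have := aP t tr; have := qDt s t sr0 tr; have := qDt 0 t N0 tr.
rewrite Nx => q1 q2 q3 q4.
have -> : Dt s - Dt 0 - a * s = (q t s - q t 0 - d t * s) + (q t 0 - Dt 0)
   - (q t s - Dt s) + (d t - a) * s by ring.
have da : N ((d t - a) * s) <= K / r * x * N s.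
  by rewrite normcM ler_wpM2r ?normc_ge0.
set A := q t s - q t 0 - _ in q4 *; set B := q t 0 - _ in q1 *.
set E := q t s - _ in q2 *; set F := _ * s in da *.
have := normcD_le (A + B - E) F; have := normcB_le (A + B) E.
have := normcD_le A B.
have : K / r * x * N s = x * (K / r * N s) by ring.
lra.
Qed.

End TaylorExpansion.

(** * The bound on the second coefficient *)

Section SecondCoefficient.
Context {R : realType}.
Local Notation C := R[i].
Local Notation N := (@normc R).
Implicit Types (f F G : C -> C) (a b c p t w z : C).

Lemma mul_conjc z : z * z^*%C = (N z ^+ 2)%:C%C.
Proof. by rewrite -sqr_normc normr_normc rmorphXn. Qed.

Lemma circle_mean_conj n w r F :
  circle_mean n w r (fun t => (F t)^*%C) = (circle_mean n w r F)^*%C.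
Proof.
by rewrite /circle_mean rmorphM rmorph_sum fmorphV rmorph_nat.
Qed.

Lemma ler_circle_mean n w (r : R) F G : 0 < r -> unity_root n w ->
  (forall t, N t = r -> F t <= G t) -> circle_mean n w r F <= circle_mean n w r G.
Proof.
move=> r0 wr FG; rewrite /circle_mean ler_wpM2r ?invr_ge0 ?ler0n //.
by apply: ler_sum => k _; apply/FG/(norm_circle k r0 wr).
Qed.

(** Expand the mean of |F t - a - b t|^2 >= 0; on the circle the conjugate of
    t is r^2 / t, and 1 and t are orthogonal. *)
Lemma circle_bessel n w (r : R) F a b : 0 < r -> unity_root n w ->
  circle_mean n w r F = a -> circle_mean n w r (fun t => F t / t ^+ 1) = b ->
  a * a^*%C + b * b^*%C * (r ^+ 2)%:C%C
    <= circle_mean n w r (fun t => F t * (F t)^*%C).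
Proof.
move=> r0 wr Fa Fb; have [n0 _ w1 _] := wr.
set s : C := (r ^+ 2)%:C%C.
have s0 : s != 0 by rewrite -normc_eq0 normc_real normr_eq0 expf_neq0 // gt_eqF.
have sE : (r ^+ 2)%:C%C = s by [].
clearbody s.
have : 0 <= circle_mean n w r
    (fun t => (F t - a - b * t) * (F t - a - b * t)^*%C).
  rewrite -(circle_mean_cst w r (0 : C) n0); apply: ler_circle_mean => // t _.
  exact: mulcJ_ge0.
suff -> : circle_mean n w r (fun t => (F t - a - b * t) * (F t - a - b * t)^*%C) =
    circle_mean n w r (fun t => F t * (F t)^*%C) - (a * a^*%C + b * b^*%C * s).
  by rewrite subr_ge0.
have -> : circle_mean n w r (fun t => (F t - a - b * t) * (F t - a - b * t)^*%C) =
  circle_mean n w r (fun t => F t * (F t)^*%C + F t * (- a^*%C)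
    + F t / t ^+ 1 * (- b^*%C * s) + (F t)^*%C * (- a)
    + (F t / t ^+ 1)^*%C * (- b * s) + (a * a^*%C + b * b^*%C * s)
    + (t ^+ 1)^-1 * (a * b^*%C * s) + ((t ^+ 1)^-1)^*%C * (a^*%C * b * s)).
  apply: circle_mean_eq => // t tr.
  have t0 : t != 0 by rewrite -normc_eq0 tr gt_eqF.
  have -> : (t ^+ 1)^-1^*%C = t / s.
    rewrite expr1 conjc_inv; apply: (canRL (mulfK s0)); rewrite -sE -tr.
    by rewrite -mul_conjc [t * _]mulrC mulKf // conjc_eq0.
  have -> : (F t / t ^+ 1)^*%C = (F t)^*%C * (t / s).
    rewrite rmorphM /=; congr (_ * _); rewrite expr1 conjc_inv.
    apply: (canRL (mulfK s0)); rewrite -sE -tr.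
    by rewrite -mul_conjc [t * _]mulrC mulKf // conjc_eq0.
  have -> : (F t - a - b * t)^*%C = (F t)^*%C - a^*%C - b^*%C * (s / t).
    rewrite !rmorphB rmorphM /=; congr (_ - _ * _).
    by rewrite -sE -tr -mul_conjc mulrC mulKf.
  by rewrite expr1; field; rewrite s0 t0.
rewrite !circle_meanD !circle_meanZ !circle_mean_conj !circle_mean_cst //.
rewrite circle_mean_invX ?[w ^+ 1]expr1 // conjc0 !mul0r !addr0 Fa Fb.
ring.
Qed.

(** Bessel's inequality for F t = f t (1/t + c), together with
    |F t| <= |1/t + c|, whose square has mean 1/r^2 + |c|^2. When f 0 = 0,
    the coefficient of index 0 is negligible. *)
Lemma coeff_quadratic f n w (r : R) c : 0 < r -> unity_root n w ->
  (forall t, N t = r -> N (f t) <= 1) ->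
  N (coeff n w r f 1 + c * coeff n w r f 0) ^+ 2
   + r ^+ 2 * N (coeff n w r f 2 + c * coeff n w r f 1) ^+ 2
   <= 1 / r ^+ 2 + N c ^+ 2.
Proof.
move=> r0 wr f1; have [n0 _ w1 _] := wr.
pose F t := f t * ((t ^+ 1)^-1 + c).
have Fa : circle_mean n w r F = coeff n w r f 1 + c * coeff n w r f 0.
  rewrite [c * _]mulrC -circle_meanZ -circle_meanD; apply: circle_mean_eq => //
    t tr.
  by rewrite /F expr0 divr1 mulrDr.
have Fb : circle_mean n w r (fun t => F t / t ^+ 1) =
    coeff n w r f 2 + c * coeff n w r f 1.
  rewrite [c * _]mulrC -circle_meanZ -circle_meanD; apply: circle_mean_eq => //
    t tr.
  have t0 : t != 0 by rewrite -normc_eq0 tr gt_eqF.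
  by rewrite /F expr1; field.
have FG : circle_mean n w r (fun t => F t * (F t)^*%C) <=
    circle_mean n w r (fun t => ((t ^+ 1)^-1 + c) * ((t ^+ 1)^-1 + c)^*%C).
  apply: ler_circle_mean => // t tr; rewrite !mul_conjc lecR.
  rewrite lerXn2r ?nnegrE ?normc_ge0 // normcM.
  by have := f1 t tr; have := normc_ge0 ((t ^+ 1)^-1 + c); nra.
have := le_trans (circle_bessel r0 wr Fa Fb) FG.
have -> : circle_mean n w r (fun t => ((t ^+ 1)^-1 + c) * ((t ^+ 1)^-1 + c)^*%C) =
    circle_mean n w r (fun t => (t ^+ 1)^-1 * c^*%C + ((t ^+ 1)^-1)^*%C * c
      + ((1 / r ^+ 2)%:C%C + c * c^*%C)).
  apply: circle_mean_eq => // t tr.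
  have -> : (1 / r ^+ 2)%:C%C = (t ^+ 1)^-1 * ((t ^+ 1)^-1)^*%C.
    by rewrite mul_conjc expr1 normcV tr exprVn div1r.
  rewrite rmorphD /=; ring.
rewrite !circle_meanD !circle_meanZ circle_mean_conj !circle_mean_cst //.
rewrite circle_mean_invX ?[w ^+ 1]expr1 // conjc0 !mul0r !add0r !mul_conjc.
by rewrite -!rmorphM -!rmorphD /= lecR [_ * r ^+ 2]mulrC.
Qed.

(** The free parameter c of [coeff_quadratic] is the conjugate of f'(0),
    rotated so that c f'(0) has the argument of the second coefficient. *)
Lemma second_coeff_le f (f1 : C -> C) a : bounded_holo f 1 1 -> f 0 = 0 ->
  (forall z, N z < 1 -> cdiff f z (f1 z)) -> cdiff f1 0 a ->
  N a <= 2 * (1 - N (f1 0) ^+ 2).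
Proof.
move=> fh f0 fd f1a; have [_ fM] := fh.
set b := f1 0; set B := N b.
have fb : cdiff f 0 b by apply: fd; rewrite normc0.
have B0 : 0 <= B by exact: normc_ge0.
pose a2 := a / 2; set A := N a2.
have A0 : 0 <= A by exact: normc_ge0.
suff : A + B ^+ 2 <= 1 by rewrite /A normc_half; lra.
have [u [u1 ua]] : exists u, N u = 1 /\ a2 = A%:C%C * u.
  have [a20|a20] := eqVneq a2 0.
    by exists 1; rewrite normc1 /A a20 normc0 mul0r.
  have A1 : A != 0 by rewrite normc_eq0.
  have A1' : A%:C%C != 0 :> C by rewrite -normc_eq0 normc_real normr_eq0.
  exists (a2 / A%:C%C); rewrite normcM normcV normc_real ger0_norm //.
  by rewrite -/A divff //; split=> //; field.
pose c := b^*%C * u.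
have Nc : N c = B.
  by rewrite normcM u1 mulr1 /B; case: (b) => x y /=; rewrite sqrrN.
have a2cb : N (a2 + c * b) = A + B ^+ 2.
  have -> : a2 + c * b = (A + B ^+ 2)%:C%C * u.
    by rewrite ua rmorphD /= /B -mul_conjc /c; ring.
  by rewrite normcM u1 mulr1 normc_real ger0_norm // addr_ge0 ?exprn_ge0.
set x := A + B ^+ 2.
have x0 : 0 <= x by rewrite addr_ge0 ?exprn_ge0.
have key (r : R) : 0 < r -> r < 1 -> r ^+ 2 * x <= 1.
  move=> r0 r1.
  have [a2' [a2'P ca2]] := cdiff_taylor2 r0 r1 fh fd.
  have {a2'P}ea2 : a2' = a2.
    by have := cdiff_unique a2'P f1a; rewrite /a2 => <-; field.
  rewrite {}ea2 in ca2.
  suff h : r ^+ 2 * x ^+ 2 <= 1 / r ^+ 2.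
    have r20 : 0 < r ^+ 2 by rewrite exprn_gt0.
    have : (r ^+ 2 * x) ^+ 2 <= 1 by move: h; rewrite ler_pdivlMr //; lra.
    by rewrite expr_le1 // mulr_ge0 // ltW.
  (* L collects the first-order effect of an error d = e / L in each of the
     three coefficients. *)
  apply/ler_addgt0Pr => e e0.
  pose L := 2 * (1 + B) * (B + x * r ^+ 2) + 1.
  have L0 : 0 < L.
    have : 0 <= x * r ^+ 2 by rewrite mulr_ge0 ?exprn_ge0 // ltW.
    rewrite /L => ?; have : 0 <= (1 + B) * (B + x * r ^+ 2) by rewrite mulr_ge0
      //; lra.
    lra.
  have d0 : 0 < e / L by rewrite divr_gt0.
  have [d1 d10 d1P] := coeff0_cvg r0 r1 fh d0.
  have [d2 d20 d2P] := coeff1_cvg r0 r1 fh fb d0.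
  have [d3 d30 d3P] := ca2 _ d0.
  have dd : 0 < Num.min d1 (Num.min d2 d3) by rewrite !lt_min d10 d20.
  have [n [w [wr]]] := unity_root_near1 dd; rewrite !lt_min => /and3P[wd1 wd2 wd3].
  have := d1P n w wr wd1; have := d2P n w wr wd2; have := d3P n w wr wd3.
  rewrite f0 subr0.
  have := coeff_quadratic c r0 wr (fun t tr => fM t ltac:(by rewrite tr)).
  set m0 := coeff _ _ _ _ 0; set m1 := coeff _ _ _ _ 1; set m2 := coeff _ _ _ _ 2.
  rewrite Nc; set d := e / L => quad m2e m1e m0e.
  have e1 : B - (1 + B) * d <= N (m1 + c * m0).
    have := normcB_le (m1 + c * m0) ((m1 - b) + c * m0).
    have -> : m1 + c * m0 - (m1 - b + c * m0) = b by ring.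
    rewrite -/B => h; have := normcD_le (m1 - b) (c * m0); rewrite normcM Nc.
    have : B * N m0 <= B * d by rewrite ler_wpM2l.
    lra.
  have e2 : x - (1 + B) * d <= N (m2 + c * m1).
    have := normcB_le (m2 + c * m1) ((m2 - a2) + c * (m1 - b)).
    have -> : m2 + c * m1 - (m2 - a2 + c * (m1 - b)) = a2 + c * b by ring.
    rewrite a2cb => h; have := normcD_le (m2 - a2) (c * (m1 - b)); rewrite
      normcM Nc.
    have : B * N (m1 - b) <= B * d by rewrite ler_wpM2l.
    rewrite -/x in h *; lra.
  have sq (y z s : R) : 0 <= y -> 0 <= z -> 0 <= s -> y - s <= z -> y ^+ 2 - 2
    * s * y <= z ^+ 2.
    move=> y0 z0 s0 yz; have [ys|ys] := lerP y s; first nra.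
    have : (y - s) ^+ 2 <= z ^+ 2 by rewrite lerXn2r ?nnegrE //; lra.
    nra.
  have d_ge0 : 0 <= (1 + B) * d by rewrite mulr_ge0 ?ltW //; lra.
  have s1 := sq _ _ _ B0 (normc_ge0 _) d_ge0 e1.
  have s2 := sq _ _ _ x0 (normc_ge0 _) d_ge0 e2.
  have r20 : 0 <= r ^+ 2 by rewrite exprn_ge0 // ltW.
  have s3 := ler_wpM2l r20 s2.
  have Ld : L * d = e by rewrite /d mulrC divfK // gt_eqF.
  rewrite /L in Ld; have : 0 < d := d0; lra.
apply/ler_addgt0Pr => e e0.
pose y := Num.min (1 / 2) (e / (2 * (x + 1))).
have y0 : 0 < y by rewrite lt_min divr_gt0 //= divr_gt0 // mulr_gt0 //; lra.
have y1 : y <= 1 / 2 by rewrite ge_min lexx.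
have ye : y * (2 * (x + 1)) <= e.
  by rewrite -ler_pdivlMr ?ge_min ?lexx ?orbT //; lra.
have := key (1 - y) ltac:(lra) ltac:(lra).
nra.
Qed.

End SecondCoefficient.

(** * Disc automorphisms and the function g *)

Section DiscAutomorphisms.
Context {R : realType}.
Local Notation C := R[i].
Local Notation N := (@normc R).
Implicit Types (a b z : C).

Lemma normr_lt1 z : (`|z| < 1) = (N z < 1).
Proof. by rewrite normr_normc -(rmorph1 (real_complex R)) ltcR. Qed.

Lemma denom_neq0 a b : N a < 1 -> N b < 1 -> 1 - b^* * a != 0.
Proof.
move=> a1 b1; rewrite subr_eq0; apply/eqP => ab.
have : N (b^* * a) < 1.
  rewrite -normr_lt1 normrM norm_conjC normr_normc (normr_normc a) -rmorphM.
  rewrite -(rmorph1 (real_complex R)) ltcR.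
  have := normc_ge0 a; have := normc_ge0 b; nra.
by rewrite -ab normc1 ltxx.
Qed.

(** |1 - b^* a|^2 - |a - b|^2 = (1 - |a|^2) (1 - |b|^2), where b^* is the
    conjugate of b. *)
Lemma disc_automorphism_lt1 a b : N a < 1 -> N b < 1 ->
  N ((a - b) / (1 - b^* * a)) < 1.
Proof.
move=> a1 b1; have d0 := denom_neq0 a1 b1.
rewrite normcM normcV ltr_pdivrMr ?normc_gt0 // mul1r.
have sqE z : ((N z ^+ 2)%:C%C : C) = z * z^* by rewrite -normCK normr_normc
  rmorphXn.
have : N (1 - b^* * a) ^+ 2 - N (a - b) ^+ 2 = (1 - N a ^+ 2) * (1 - N b ^+ 2).
  apply: complexI; rewrite rmorphM !rmorphB rmorph1 /= !sqE.
  by rewrite !rmorphB rmorphM rmorph1 /= conjCK; ring.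
have a2 : N a ^+ 2 < 1 by rewrite expr_lt1 // normc_ge0.
have b2 : N b ^+ 2 < 1 by rewrite expr_lt1 // normc_ge0.
have : 0 < (1 - N a ^+ 2) * (1 - N b ^+ 2) by rewrite mulr_gt0; lra.
move=> h1 h2; rewrite -(@ltr_pXn2r _ 2) ?nnegrE ?normc_ge0 //; lra.
Qed.

End DiscAutomorphisms.

Section PeschlFunction.
Context {R : realType} {n : nat}.
Local Notation C := R[i].
Local Notation N := (@normc R).
Implicit Types (w z u v : 'rV[C]_n) (f g : 'rV[C]_n -> C).

Lemma polydiscP z : polydisc z <-> forall j, N (z ord0 j) < 1.
Proof. by split=> zP j; have := zP j; rewrite normr_lt1. Qed.

Lemma mobius_polydisc w z : polydisc w -> polydisc z -> polydisc (mobius w z).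
Proof.
move=> /polydiscP wP /polydiscP zP; apply/polydiscP => j; rewrite mxE.
have wN : N (- w ord0 j) < 1 by rewrite normc_opp.
by have := disc_automorphism_lt1 (zP j) wN; rewrite opprK rmorphN mulNr opprK.
Qed.

Lemma mobius0 w : mobius w 0 = w.
Proof. by apply/rowP => j; rewrite !mxE add0r mulr0 addr0 divr1. Qed.

Lemma mobius_differentiable w z : polydisc w -> polydisc z ->
  differentiable (mobius w) z.
Proof.
move=> /polydiscP wP /polydiscP zP.
pose m j (x : 'rV[C]_n) : C := (x ord0 j + w ord0 j) / (1 + (w ord0 j)^* * x
  ord0 j).
pose F j : 'rV[C]_n -> 'rV[C]_n := fun x => m j x *: delta_mx ord0 j.
have -> : mobius w = \sum_(j < n) F j.
  apply/funext => x; rewrite fct_sumE; apply/rowP => j.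
  rewrite !mxE summxE (bigD1 j) //= !mxE !eqxx mulr1 big1 ?addr0 // => k kj.
  by rewrite !mxE [j == k]eq_sym (negPf kj) andbF mulr0.
apply: differentiable_sum => j; apply: differentiableZl.
have dc : differentiable (fun x : 'rV[C]_n => x ord0 j) z.
  exact: differentiable_coord.
have dn : differentiable (fun x : 'rV[C]_n => x ord0 j + w ord0 j) z.
  by apply: differentiableD => //; exact: differentiable_cst.
have dd : differentiable (fun x : 'rV[C]_n => 1 + (w ord0 j)^* * x ord0 j) z.
  apply: differentiableD; first exact: differentiable_cst.
  exact: (differentiableZ (w ord0 j)^* dc).
have d0 : 1 + (w ord0 j)^* * z ord0 j != 0.
  have wN : N (- w ord0 j) < 1 by rewrite normc_opp.
  by have := denom_neq0 (zP j) wN; rewrite rmorphN mulNr opprK.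
exact: (differentiableM dn (differentiableV dd d0)).
Qed.

Context (f : 'rV[C]_n -> C) (w : 'rV[C]_n).
Context (wP : polydisc w) (fd : holomorphic_on_polydisc f).
Context (fD : forall z, polydisc z -> `|f z| < 1).

Lemma peschl_g_differentiable z : polydisc z -> differentiable (peschl_g f w) z.
Proof.
move=> zP; have mP := mobius_polydisc wP zP.
have dfm : differentiable (f \o mobius w) z.
  by apply: differentiable_comp; [exact: mobius_differentiable|exact: fd].
have dn : differentiable (fun x => f (mobius w x) - f w) z.
  by apply: differentiableB => //; exact: differentiable_cst.
have dd : differentiable (fun x => 1 - (f w)^* * f (mobius w x)) z.
  apply: differentiableB; first exact: differentiable_cst.
  exact: (differentiableZ (f w)^* dfm).
have d0 : 1 - (f w)^* * f (mobius w z) != 0.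
  by apply: denom_neq0; rewrite -normr_lt1; exact: fD.
exact: (differentiableM dn (differentiableV dd d0)).
Qed.

Lemma peschl_g_lt1 z : polydisc z -> N (peschl_g f w z) < 1.
Proof.
move=> zP; apply: disc_automorphism_lt1; rewrite -normr_lt1; apply: fD => //.
exact: mobius_polydisc.
Qed.

Lemma peschl_g0 : peschl_g f w 0 = 0.
Proof. by rewrite /peschl_g mobius0 subrr mul0r. Qed.

End PeschlFunction.

(** * Second derivatives along the diagonal *)

Section LinearSlices.
Context {R : realType} {n : nat}.
Local Notation C := R[i].
Local Notation N := (@normc R).
Implicit Types (z u v : 'rV[C]_n) (g : 'rV[C]_n -> C).

Lemma cdiff_line g z v (t : C) : differentiable g (z + t *: v) ->
  cdiff (fun x => g (z + x *: v)) t ('D_v g (z + t *: v)).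
Proof.
move=> dg; have /derivableP/cdiff_is_derive gv := @diff_derivable _ _ _ g _ v dg.
rewrite -[t in cdiff _ t]addr0; apply/cdiff_shift.
by congr (cdiff _ 0 _): gv; apply/funext => h; rewrite scalerDl [t *: v +
  _]addrC addrCA.
Qed.

Lemma derive_at0 g v a : cdiff (fun s => g (s *: v)) 0 a -> 'D_v g 0 = a.
Proof.
move=> ga; apply: derive_val; apply/cdiff_is_derive.
by congr (cdiff _ 0 a): ga; apply/funext => s; rewrite addr0.
Qed.

Lemma cdiff_sum m (F : 'I_m -> C -> C) (a : 'I_m -> C) x :
  (forall i, cdiff (F i) x (a i)) ->
  cdiff (fun y => \sum_(i < m) F i y) x (\sum_(i < m) a i).
Proof.
move=> Fa; apply/cdiff_derive1.
have Fd i : is_derive x 1 (F i) (a i) by apply/cdiff_derive1.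
have -> : (fun y => \sum_(i < m) F i y) = \sum_(i < m) F i.
  by apply/funext => y; rewrite fct_sumE.
exact: is_derive_sum.
Qed.

Lemma cdiff_local (f h : C -> C) (z a : C) (r : R) : 0 < r ->
  (forall x, N (x - z) < r -> f x = h x) -> cdiff f z a -> cdiff h z a.
Proof.
move=> r0 fh fa e /fa[d d0 dP]; exists (Num.min d r); first by rewrite lt_min d0.
move=> x; rewrite lt_min => /andP[/dP fx xr].
by rewrite -!fh ?subrr ?normc0 // addrC addKr.
Qed.

Lemma derive_sum_delta g z v : differentiable g z ->
  'D_v g z = \sum_(j < n) v ord0 j * 'D_(delta_mx ord0 j) g z.
Proof.
move=> dg; rewrite deriveE // {1}(row_sum_delta v) linear_sum.
by apply: eq_bigr => j _; rewrite linearZ deriveE.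
Qed.

Definition unit_direction v := forall j, N (v ord0 j) <= 1.

Lemma polydisc_scale v (t : C) : unit_direction v -> N t < 1 ->
  polydisc (t *: v).
Proof.
move=> v1 t1; apply/polydiscP => j; rewrite mxE normcM.
by have := v1 j; have := normc_ge0 t; have := normc_ge0 (v ord0 j); nra.
Qed.

Lemma polydisc_scale2 u v (s t : C) : unit_direction u -> unit_direction v ->
  N s < 1 / 2 -> N t < 1 / 2 -> polydisc (s *: u + t *: v).
Proof.
move=> u1 v1 s1 t1; apply/polydiscP => j; rewrite !mxE.
apply: le_lt_trans (normcD_le _ _) _; rewrite !normcM.
have := u1 j; have := v1 j; have := normc_ge0 s; have := normc_ge0 t.
by have := normc_ge0 (u ord0 j); have := normc_ge0 (v ord0 j); nra.
Qed.

(** The plane spanned by u and v meets the polydisc in a domain that contains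
    the bidisc of radius 1/2, to which [cdiff_mixed] applies. *)
Lemma mixed_derivatives g u v :
  (forall z, polydisc z -> differentiable g z) ->
  (forall z, polydisc z -> N (g z) <= 1) ->
  unit_direction u -> unit_direction v ->
  cdiff (fun s => 'D_v g (s *: u)) 0 ('D_u ('D_v g) 0) /\
  'D_u ('D_v g) 0 = 'D_v ('D_u g) 0.
Proof.
move=> dg g1 u1 v1; pose G s t := g (s *: u + t *: v).
have h0 : 0 < 1 / 2 :> R by lra.
have N0 : N (0 : C) < 1 / 2 by rewrite normc0.
have Gs s t : N s < 1 / 2 -> N t < 1 / 2 ->
    cdiff (G s) t ('D_v g (s *: u + t *: v)).
  by move=> s1 t1; apply/cdiff_line/dg/polydisc_scale2.
have Gt s t : N s < 1 / 2 -> N t < 1 / 2 ->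
    cdiff (G^~ t) s ('D_u g (s *: u + t *: v)).
  move=> s1 t1; have := @cdiff_line g (t *: v) u s; rewrite addrC.
  move=> /(_ (dg _ (polydisc_scale2 u1 v1 s1 t1))).
  by congr (cdiff _ _ _); apply/funext => x; rewrite addrC.
have [||||a [Da Db]] := @cdiff_mixed _ G (1 / 2) 1
    (fun t => 'D_u g (t *: v)) (fun s => 'D_v g (s *: u)) h0.
- move=> s s1; split=> t t1; first by eexists; exact: Gs.
  exact/g1/polydisc_scale2.
- move=> t t1; split=> s s1; first by eexists; exact: Gt.
  exact/g1/polydisc_scale2.
- by move=> s s1; have := Gs s 0 s1 N0; rewrite scale0r addr0.
- by move=> t t1; have := Gt 0 t N0 t1; rewrite scale0r add0r.
have Eu := @derive_at0 ('D_v g) u a Da.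
have Ev := @derive_at0 ('D_u g) v a Db.
by split; [move: Da; rewrite -Eu|exact: etrans Eu (esym Ev)].
Qed.

Lemma sum_symmetric (c : 'I_n -> 'I_n -> C) : (forall j k, c j k = c k j) ->
  \sum_(j < n) \sum_(k < n) c j k =
  \sum_(j < n) c j j + 2 * \sum_(j < n) \sum_(k < n | (j < k)%N) c j k.
Proof.
move=> cC.
have -> : \sum_(j < n) \sum_(k < n) c j k = \sum_(j < n) (c j j +
    (\sum_(k < n | (j < k)%N) c j k + \sum_(k < n | (k < j)%N) c j k)).
  apply: eq_bigr => j _; rewrite (bigD1 j) //=; congr (_ + _).
  rewrite (bigID (fun k : 'I_n => (j < k)%N)) /=; congr (_ + _).
    by apply: eq_bigl => k; rewrite -(inj_eq val_inj) /=; lia.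
  apply: eq_bigl => k; rewrite -leqNgt -(inj_eq val_inj) /=; lia.
rewrite !big_split /= mulr_natl mulr2n; congr (_ + (_ + _)).
rewrite (exchange_big_dep xpredT) //=.
by apply: eq_bigr => j _; apply: eq_bigr.
Qed.

(** The derivative in the direction (1, ..., 1) is the sum of the partial
    derivatives, but differentiating that sum again along the diagonal would
    need the partial derivatives to be differentiable at 0. Exchanging the two
    derivatives first ([mixed_derivatives]) leaves only derivatives of g
    itself, whose linearity in the direction is known. *)
Lemma diagonal_second_derivative g :
  (forall z, polydisc z -> differentiable g z) ->
  (forall z, polydisc z -> N (g z) <= 1) ->
  cdiff (fun s => 'D_(const_mx 1) g (s *: const_mx 1)) 0
   (\sum_(j < n) partial j (partial j g) 0
    + 2 * \sum_(j < n) \sum_(k < n | (j < k)%N) partial j (partial k g) 0).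
Proof.
move=> dg g1; pose one : 'rV[C]_n := const_mx 1.
have one1 : unit_direction one by move=> j; rewrite mxE normc1.
have delta1 j : unit_direction (delta_mx ord0 j : 'rV[C]_n).
  by move=> k; rewrite mxE; case: (_ && _); rewrite ?normc1 ?normc0.
have D1E z : polydisc z -> 'D_one g z = \sum_(j < n) partial j g z.
  move=> /dg /derive_sum_delta ->; apply: eq_bigr => j _.
  by rewrite mxE mul1r.
have Dk k : 'D_one (partial k g) 0 = \sum_(j < n) partial k (partial j g) 0.
  have [Da Eab] := mixed_derivatives dg g1 (delta1 k) one1.
  have [_ <-] := mixed_derivatives dg g1 (delta1 k) one1.
  apply: (cdiff_unique Da).
  apply: (@cdiff_local (fun s => \sum_(j < n) partial j g (s *: delta_mx ord0
    k)) _ _ _ 1 ltr01).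
    by move=> x; rewrite subr0 => x1; apply/esym/D1E/polydisc_scale.
  apply: cdiff_sum => j.
  by have [] := mixed_derivatives dg g1 (delta1 k) (delta1 j).
rewrite -(@sum_symmetric (fun j k => partial j (partial k g) 0)); last first.
  by move=> j k; have [_] := mixed_derivatives dg g1 (delta1 j) (delta1 k).
apply: (@cdiff_local (fun s => \sum_(k < n) partial k g (s *: one)) _ _ _ 1 ltr01).
  by move=> x; rewrite subr0 => x1; apply/esym/D1E/polydisc_scale.
have -> : \sum_(j < n) \sum_(k < n) (fun j k => partial j (partial k g) 0) j k =
    \sum_(k < n) 'D_one (partial k g) 0.
  by apply: eq_bigr => k _; apply/esym/Dk.
apply: (@cdiff_sum n (fun k s => partial k g (s *: one))) => k.
by have [] := mixed_derivatives dg g1 one1 (delta1 k).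
Qed.

End LinearSlices.

(** * The inequality *)
Theorem theorem4p4 (R : realType) (n : nat) (w : 'rV[R[i]]_n)
    (f : 'rV[R[i]]_n -> R[i]) (hn : (1 <= n)%N) (hw : polydisc w)
    (hf : holomorphic_on_polydisc f)
    (hfD : forall z, polydisc z -> `|f z| < 1) :
  `|D2 f w| <= 2 * (1 - `|D1 f w| ^+ 2).
Proof.
set g := peschl_g f w.
have dg z : polydisc z -> differentiable g z by exact: peschl_g_differentiable.
have g1 z : polydisc z -> normc (g z) <= 1.
  by move=> zP; apply/ltW/peschl_g_lt1.
pose one : 'rV[R[i]]_n := const_mx 1.
have one1 : unit_direction one by move=> j; rewrite mxE normc1.
have P0 : polydisc (0 : 'rV[R[i]]_n).
  by apply/polydiscP => j; rewrite mxE normc0 ltr01.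
pose phi (s : R[i]) := g (s *: one).
have dphi s : normc s < 1 -> cdiff phi s ('D_one g (s *: one)).
  move=> s1; have := @cdiff_line _ _ g 0 one s; rewrite add0r.
  move=> /(_ (dg _ (polydisc_scale one1 s1))).
  by congr (cdiff _ _ _); apply/funext => x; rewrite add0r.
have phi_holo : bounded_holo phi 1 1.
  split=> s s1; first by eexists; exact: dphi.
  exact/g1/polydisc_scale.
have phi0 : phi 0 = 0 by rewrite /phi scale0r; exact: peschl_g0.
have := second_coeff_le phi_holo phi0 dphi (diagonal_second_derivative dg g1).
rewrite scale0r -/one -/(D2 f w).
have -> : 'D_one g 0 = D1 f w.
  rewrite derive_sum_delta; last exact: dg.
  by apply: eq_bigr => j _; rewrite mxE mul1r.
rewrite -lecR !normr_normc => /le_trans; apply.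
by rewrite rmorphM rmorphB rmorphXn !rmorph_nat.
Qed.
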